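(* Let $\mathbb{F}$ be a field of characteristic different from $2$, let $K_3=\mathbb{F}a\oplus W$ be the Kaplansky superalgebra and $K_{10}$ Kac's ten-dimensional Jordan superalgebra over $\mathbb{F}$. Identify $\mathbf{Aut}(K_{10})$ with $\bigl(\mathbf{SL}(W)\times\mathbf{SL}(W)\bigr)\rtimes\mathsf{C}_2$ by means of the isomorphism $\Phi$ of affine group schemes described in the context. Then the canonical projection $\pi:\bigl(\mathbf{SL}(W)\times\mathbf{SL}(W)\bigr)\rtimes\mathsf{C}_2\to\mathsf{C}_2$ induces a bijection of pointed sets $$\pi_*:H^1\bigl(\mathbb{F},\mathbf{Aut}(K_{10})\bigr)\longrightarrow H^1(\mathbb{F},\mathsf{C}_2).$$
   Context: Superalgebras are $\mathbb{Z}_2$-graded (nonassociative) algebras; in an exponent of $-1$, a homogeneous element stands for its parity. The Kaplansky superalgebra $K_3$ over $\mathbb{F}$: $(K_3)_{\bar 0}=\mathbb{F}a$ and $(K_3)_{\bar 1}=W$ is a two-dimensional vector space with a nonzero skew-symmetric bilinear form $(\cdot\mid\cdot)$; the multiplication is $a^2=a$, $av=\frac12 v=va$, $vw=(v\mid w)a$ for $v,w\in W$. The form is extended to $K_3$ by making $(K_3)_{\bar 0}$ and $(K_3)_{\bar 1}$ orthogonal and $(a\mid a)=\frac12$. Kac's superalgebra $K_{10}=\mathbb{F}1\oplus(K_3\otimes_{\mathbb{F}}K_3)$ has $(K_{10})_{\bar 0}=\mathbb{F}1\oplus\mathbb{F}(a\otimes a)\oplus(W\otimes W)$ and $(K_{10})_{\bar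 1}=(W\otimes a)\oplus(a\otimes W)$; the element $1$ is the unity and, for homogeneous $x,y,z,t\in K_3$, $$(x\otimes y)(z\otimes t)=(-1)^{yz}\Bigl(xz\otimes yt-\tfrac34 (x\mid z)(y\mid t)1\Bigr).$$ Affine group schemes over $\mathbb{F}$ are representable group-valued functors on unital commutative associative $\mathbb{F}$-algebras $R$. $\mathbf{Aut}(\mathcal{A})(R)$ is the group of $R$-linear automorphisms of $\mathcal{A}\otimes_{\mathbb{F}}R$ preserving the multiplication and the $\mathbb{Z}_2$-grading; $\mathbf{SL}(W)(R)$ is the group of $R$-linear endomorphisms of $W\otimes_{\mathbb F}R$ of determinant $1$; $\mathsf{C}_2$ is the constant group scheme attached to the cyclic group of order two, acting on $\mathbf{SL}(W)\times\mathbf{SL}(W)$ by swapping the factors, and the semidirect product is formed with respect to this action. The isomorphism $\Phi:\bigl(\mathbf{SL}(W)\times\mathbf{SL}(W)\bigr)\rtimes\mathsf{C}_2\to\mathbf{Aut}(K_{10})$ sends $(f,g)$ to the automorphism with $1\mapsto1$, $a\otimes a\mapsto a\otimes a$, $v\otimes a\mapsto f(v)\otimes a$, $a\otimes v\mapsto a\otimes g(v)$, $v\otimes w\mapsto f(v)\otimes g(w)$ ($v,w\in W\otimes_{\mathbb F}R$), and sends the generator of $\mathsf{C}_2$ to the automorphism $\tau$ with $1\mapsto 1$, $x\otimes y\mapsto(-1)^{xy}y\otimes x$. For an affine group scheme $\mathbf{G}$ over $\mathbb{F}$, $H^1(\mathbb{F},\mathbf{G})$ denotes $H^1(\overline{\mathbb{F}}/\mathbb{F},\mathbf{G})$,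 with $\overline{\mathbb{F}}$ an algebraic closure of $\mathbb{F}$: the pointed set of classes of elements $\varphi\in\mathbf{G}(\overline{\mathbb{F}}\otimes_{\mathbb{F}}\overline{\mathbb{F}})$ satisfying the cocycle condition $(d^0\varphi)(d^2\varphi)=d^1\varphi$ in $\mathbf{G}(\overline{\mathbb{F}}\otimes_{\mathbb F}\overline{\mathbb{F}}\otimes_{\mathbb F}\overline{\mathbb{F}})$, where $\varphi\sim\varphi'$ if $\varphi'=(d^0\lambda)\varphi(d^1\lambda)^{-1}$ for some $\lambda\in\mathbf{G}(\overline{\mathbb{F}})$; here $d^i$ is induced by the algebra map inserting $1$ in the $i$-th tensor slot (slots numbered from $0$). The class of the identity is the distinguished point. $H^1(\mathbb{F},\mathbf{Aut}(K_{10}))$ is identified with the set of isomorphism classes of twisted forms of $K_{10}$, i.e. of $\mathbb{F}$-superalgebras that become isomorphic to $K_{10}$ over $\overline{\mathbb{F}}$. *)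

(* Defs.v *)
From HB Require Import structures.
From mathcomp Require Import all_boot all_fingroup all_algebra.
From mathcomp Require Import ring boolp.

Set Implicit Arguments.
Unset Strict Implicit.
Unset Printing Implicit Defensive.

Import GRing.Theory.
Local Open Scope ring_scope.
Local Open Scope quotient_scope.

(* A commutative F-algebra is a commutative ring under F; the zero ring is
   allowed. *)
Record comAlg (F : fieldType) := ComAlg {
  alg_ring :> comPzRingType;
  alg_in : {rmorphism F -> alg_ring} }.

Record algHom (F : fieldType) (A B : comAlg F) := AlgHom {
  hom_fun :> {rmorphism A -> B};
  hom_in : forall c : F, hom_fun (alg_in A c) = alg_in B c }.

Section AlgHomOps.
Variable F : fieldType.

Definition hom_id (A : comAlg F) : algHom A A :=
  @AlgHom F A A idfun (fun=> erefl).

Fact hom_comp_in (A B C : comAlg F) (g : algHom B C) (f : algHom A B) c :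
  (g \o f) (alg_in A c) = alg_in C c.
Proof. by rewrite /= !hom_in. Qed.

Definition hom_comp (A B C : comAlg F) (g : algHom B C) (f : algHom A B) :
  algHom A C := @AlgHom F A C (g \o f) (hom_comp_in g f).
End AlgHomOps.

Section Tensor.
Variables (F : fieldType) (A B : comAlg F).

Definition balanced (V : zmodType) (h : A -> B -> V) :=
  [/\ forall x x' y, h (x + x') y = h x y + h x' y,
      forall x y y', h x (y + y') = h x y + h x y'
    & forall (c : F) x y, h (alg_in A c * x) y = h x (alg_in B c * y)].

Definition teval (V : zmodType) (h : A -> B -> V) (s : seq (A * B)) : V :=
  \sum_(p <- s) h p.1 p.2.

(* A list of pairs stands for the sum of the corresponding pure tensors; two
   such formal sums are identified when no balanced map separates them. The
   universal property is tens_lift_pure and tens_lift_unique below. *)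
Definition teq (s t : seq (A * B)) : bool :=
  `[< forall (V : zmodType) (h : A -> B -> V), balanced h ->
      teval h s = teval h t >].

Lemma teqP s t :
  reflect (forall (V : zmodType) (h : A -> B -> V), balanced h ->
             teval h s = teval h t) (teq s t).
Proof. exact: asboolP. Qed.

Fact teq_refl : reflexive teq.
Proof. by move=> s; apply/teqP. Qed.
Fact teq_sym : symmetric teq.
Proof. by move=> s t; apply/teqP/teqP => H V h /H. Qed.
Fact teq_trans : transitive teq.
Proof.
by move=> t s u /teqP st /teqP tu; apply/teqP => V h hb; rewrite st // tu.
Qed.

Canonical teq_equiv := EquivRel teq teq_refl teq_sym teq_trans.

Definition tens : Type := {eq_quot teq_equiv}.
HB.instance Definition _ := Choice.copy tens {eq_quot teq_equiv}.

Definition tcls (s : seq (A * B)) : tens := \pi_({eq_quot teq_equiv}) s.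
Definition pure (x : A) (y : B) : tens := tcls [:: (x, y)].

Lemma tclsP s t : teq s t -> tcls s = tcls t.
Proof. by move=> st; apply/eqP; rewrite /tcls piE. Qed.

Definition trepr (u : tens) : seq (A * B) :=
  generic_quotient.repr (u : {eq_quot teq_equiv}).

Lemma treprK u : tcls (trepr u) = u.
Proof. exact: reprK. Qed.

Lemma tcls_ind (P : tens -> Prop) : (forall s, P (tcls s)) -> forall u, P u.
Proof. by move=> H u; rewrite -(treprK u). Qed.

Definition tens_lift (V : zmodType) (h : A -> B -> V) (u : tens) : V :=
  teval h (trepr u).

Lemma tens_liftE (V : zmodType) (h : A -> B -> V) s :
  balanced h -> tens_lift h (tcls s) = teval h s.
Proof.
move=> hb; have /eqP : tcls (trepr (tcls s)) = tcls s by rewrite treprK.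
by rewrite /tcls piE => /teqP; apply.
Qed.

Definition tnegs (s : seq (A * B)) := [seq (- p.1, p.2) | p <- s].
Definition tmuls (s t : seq (A * B)) :=
  [seq (p.1 * q.1, p.2 * q.2) | p <- s, q <- t].

Definition tadd (u v : tens) := tcls (trepr u ++ trepr v).
Definition topp (u : tens) := tcls (tnegs (trepr u)).
Definition tmul (u v : tens) := tcls (tmuls (trepr u) (trepr v)).
Definition tzero : tens := tcls [::].
Definition tone : tens := pure 1 1.

Lemma trepr_teq s : teq (trepr (tcls s)) s.
Proof.
have /eqP : tcls (trepr (tcls s)) = tcls s by rewrite treprK.
by rewrite /tcls piE.
Qed.

Lemma balanced0l (V : zmodType) (h : A -> B -> V) y : balanced h -> h 0 y = 0.
Proof. by case=> hD _ _; apply: (@addrI _ (h 0 y)); rewrite -hD !addr0. Qed.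

Lemma balancedNl (V : zmodType) (h : A -> B -> V) x y :
  balanced h -> h (- x) y = - h x y.
Proof.
move=> hb; case: (hb) => hD _ _; apply: (@addrI _ (h x y)).
by rewrite -hD !subrr balanced0l.
Qed.

Lemma teval_cat (V : zmodType) (h : A -> B -> V) s t :
  teval h (s ++ t) = teval h s + teval h t.
Proof. exact: big_cat. Qed.

Lemma teval_neg (V : zmodType) (h : A -> B -> V) s :
  balanced h -> teval h (tnegs s) = - teval h s.
Proof.
move=> hb; rewrite /teval big_map -sumrN.
by apply: eq_bigr => p _ /=; rewrite balancedNl.
Qed.

Lemma teval_mul (V : zmodType) (h : A -> B -> V) s t :
  teval h (tmuls s t) =
    \sum_(p <- s) \sum_(q <- t) h (p.1 * q.1) (p.2 * q.2).
Proof. by rewrite /teval big_allpairs_dep. Qed.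

Lemma balanced_mul (V : zmodType) (h : A -> B -> V) t : balanced h ->
  balanced (fun x y => \sum_(q <- t) h (x * q.1) (y * q.2)).
Proof.
case=> hDl hDr hc; split=> [x x' y|x y y'|c x y].
- by rewrite -big_split; apply: eq_bigr => q _; rewrite mulrDl hDl.
- by rewrite -big_split; apply: eq_bigr => q _; rewrite mulrDl hDr.
- by apply: eq_bigr => q _; rewrite -!mulrA hc.
Qed.

Lemma taddE s t : tadd (tcls s) (tcls t) = tcls (s ++ t).
Proof.
apply: tclsP; apply/teqP => V h hb; rewrite !teval_cat.
by rewrite (teqP _ _ (trepr_teq s)) // (teqP _ _ (trepr_teq t)).
Qed.

Lemma toppE s : topp (tcls s) = tcls (tnegs s).
Proof.
apply: tclsP; apply/teqP => V h hb; rewrite !teval_neg //.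
by rewrite (teqP _ _ (trepr_teq s)).
Qed.

Lemma tmulsC_eval (V : zmodType) (h : A -> B -> V) s t :
  teval h (tmuls s t) = teval h (tmuls t s).
Proof.
rewrite !teval_mul exchange_big; apply: eq_bigr => p _; apply: eq_bigr => q _.
by rewrite mulrC (mulrC p.2).
Qed.

Lemma teval_mul_teq (V : zmodType) (h : A -> B -> V) s s' t :
  balanced h -> teq s s' -> teval h (tmuls s t) = teval h (tmuls s' t).
Proof.
move=> hb /teqP ss'; rewrite !teval_mul.
exact: (ss' _ _ (balanced_mul t hb)).
Qed.

Lemma tmulE s t : tmul (tcls s) (tcls t) = tcls (tmuls s t).
Proof.
apply: tclsP; apply/teqP => V h hb.
rewrite (teval_mul_teq _ hb (trepr_teq s)) tmulsC_eval.
by rewrite (teval_mul_teq _ hb (trepr_teq t)) tmulsC_eval.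
Qed.

Fact taddA : associative tadd.
Proof.
elim/tcls_ind=> s; elim/tcls_ind=> t; elim/tcls_ind=> u.
by rewrite !taddE catA.
Qed.

Fact taddC : commutative tadd.
Proof.
elim/tcls_ind=> s; elim/tcls_ind=> t; rewrite !taddE; apply: tclsP.
by apply/teqP => V h hb; rewrite !teval_cat addrC.
Qed.

Fact tadd0 : left_id tzero tadd.
Proof. by elim/tcls_ind=> s; rewrite taddE. Qed.

Fact taddN : left_inverse tzero topp tadd.
Proof.
elim/tcls_ind=> s; rewrite toppE taddE; apply: tclsP; apply/teqP => V h hb.
by rewrite teval_cat teval_neg // addNr /teval big_nil.
Qed.

HB.instance Definition _ := GRing.isZmodule.Build tens taddA taddC tadd0 taddN.

Fact tmulA : associative tmul.
Proof.
elim/tcls_ind=> s; elim/tcls_ind=> t; elim/tcls_ind=> u.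
rewrite !tmulE; apply: tclsP; apply/teqP => V h hb.
rewrite (teval_mul h (tmuls s t) u) teval_mul big_allpairs_dep.
apply: eq_bigr => p _; rewrite big_allpairs_dep.
apply: eq_bigr => q _; apply: eq_bigr => r _ /=.
by rewrite !mulrA.
Qed.

Fact tmulC : commutative tmul.
Proof.
elim/tcls_ind=> s; elim/tcls_ind=> t; rewrite !tmulE; apply: tclsP.
by apply/teqP => V h hb; rewrite tmulsC_eval.
Qed.

Fact tmul1 : left_id tone tmul.
Proof.
elim/tcls_ind=> s; rewrite tmulE; apply: tclsP; apply/teqP => V h hb.
rewrite teval_mul big_seq1 /teval.
by apply: eq_bigr => p _ /=; rewrite !mul1r.
Qed.

Fact tmulDl : left_distributive tmul tadd.
Proof.
elim/tcls_ind=> s; elim/tcls_ind=> t; elim/tcls_ind=> u.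
rewrite (taddE s t) !tmulE taddE; apply: tclsP; apply/teqP => V h hb.
by rewrite teval_cat !teval_mul big_cat.
Qed.

HB.instance Definition _ :=
  GRing.Zmodule_isComPzRing.Build tens tmulA tmulC tmul1 tmulDl.

Lemma pureM x y x' y' : pure x y * pure x' y' = pure (x * x') (y * y').
Proof. exact: tmulE. Qed.

Lemma pure_balanced : balanced (fun x y => pure x y).
Proof.
split=> [x x' y|x y y'|c x y]; rewrite /pure.
- rewrite [RHS]taddE; apply: tclsP; apply/teqP => V h hb.
  by rewrite teval_cat /teval !big_seq1; case: hb => ->.
- rewrite [RHS]taddE; apply: tclsP; apply/teqP => V h hb.
  by rewrite teval_cat /teval !big_seq1; case: hb => _ ->.
- apply: tclsP; apply/teqP => V h hb.
  by rewrite /teval !big_seq1; case: hb => _ _ ->.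
Qed.

Lemma tcls_sum s : tcls s = \sum_(p <- s) pure p.1 p.2.
Proof.
elim: s => [|[x y] s IHs]; first by rewrite big_nil.
by rewrite big_cons -IHs [RHS]taddE.
Qed.

Lemma tens_ind (P : tens -> Prop) :
  (forall s : seq (A * B), P (\sum_(p <- s) pure p.1 p.2)) -> forall u, P u.
Proof. by move=> H; elim/tcls_ind=> s; rewrite tcls_sum. Qed.

Lemma tens_lift_pure (V : zmodType) (h : A -> B -> V) x y :
  balanced h -> tens_lift h (pure x y) = h x y.
Proof. by move=> hb; rewrite tens_liftE // /teval big_seq1. Qed.

Lemma tens_liftD (V : zmodType) (h : A -> B -> V) : balanced h ->
  {morph tens_lift h : u v / u + v}.
Proof.
move=> hb; elim/tcls_ind=> s; elim/tcls_ind=> t.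
by rewrite [_ + _]taddE !tens_liftE // teval_cat.
Qed.

Lemma tens_lift_unique (V : zmodType) (h : A -> B -> V)
    (g : {additive tens -> V}) :
  balanced h -> (forall x y, g (pure x y) = h x y) -> g =1 tens_lift h.
Proof.
move=> hb gE; elim/tcls_ind=> s; rewrite tens_liftE // tcls_sum raddf_sum.
by apply: eq_bigr => p _; rewrite gE.
Qed.

Definition tens_in (c : F) : tens := pure (alg_in A c) 1.

Fact tens_in_zmod : zmod_morphism tens_in.
Proof.
move=> c d; have [pD _ _] := pure_balanced; rewrite /tens_in rmorphB.
by apply/esym/eqP; rewrite subr_eq -pD subrK.
Qed.
Fact tens_in_monoid : monoid_morphism tens_in.
Proof.
split=> [|c d]; first by rewrite /tens_in rmorph1.
by rewrite /tens_in pureM rmorphM mulr1.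
Qed.
HB.instance Definition _ := GRing.isZmodMorphism.Build F tens tens_in
  tens_in_zmod.
HB.instance Definition _ := GRing.isMonoidMorphism.Build F tens tens_in
  tens_in_monoid.

Definition tensor : comAlg F := @ComAlg F tens tens_in.

Definition tinl_fun (x : A) : tens := pure x 1.
Definition tinr_fun (y : B) : tens := pure 1 y.

Fact tinl_zmod : zmod_morphism tinl_fun.
Proof.
move=> x y; have [pD _ _] := pure_balanced.
by apply/esym/eqP; rewrite subr_eq /tinl_fun -pD subrK.
Qed.
Fact tinl_monoid : monoid_morphism tinl_fun.
Proof. by split=> // x y; rewrite /tinl_fun pureM mulr1. Qed.
HB.instance Definition _ := GRing.isZmodMorphism.Build A tens tinl_fun
  tinl_zmod.
HB.instance Definition _ := GRing.isMonoidMorphism.Build A tens tinl_fun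
  tinl_monoid.

Fact tinr_zmod : zmod_morphism tinr_fun.
Proof.
move=> x y; have [_ pD _] := pure_balanced.
by apply/esym/eqP; rewrite subr_eq /tinr_fun -pD subrK.
Qed.
Fact tinr_monoid : monoid_morphism tinr_fun.
Proof. by split=> // x y; rewrite /tinr_fun pureM mulr1. Qed.
HB.instance Definition _ := GRing.isZmodMorphism.Build B tens tinr_fun
  tinr_zmod.
HB.instance Definition _ := GRing.isMonoidMorphism.Build B tens tinr_fun
  tinr_monoid.

Fact tinr_in c : tinr_fun (alg_in B c) = tens_in c.
Proof.
have [_ _ pc] := pure_balanced.
by rewrite /tens_in -[alg_in A c]mulr1 pc mulr1.
Qed.

Definition tinl : algHom A tensor :=
  @AlgHom F A tensor tinl_fun (fun=> erefl).
Definition tinr : algHom B tensor := @AlgHom F B tensor tinr_fun tinr_in.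
End Tensor.

Section TensorMap.
Variables (F : fieldType) (A B A' B' : comAlg F).
Variables (f : algHom A A') (g : algHom B B').

Definition tmap_fun : tens A B -> tens A' B' :=
  tens_lift (fun x y => pure (f x) (g y)).

Lemma tmap_balanced : balanced (fun x y => pure (f x) (g y)).
Proof.
have [pDl pDr pc] := pure_balanced A' B'.
split=> [x x' y|x y y'|c x y]; rewrite ?rmorphD ?pDl ?pDr //.
by rewrite !rmorphM !hom_in pc.
Qed.

Lemma tmap_pure x y : tmap_fun (pure x y) = pure (f x) (g y).
Proof. exact: tens_lift_pure tmap_balanced. Qed.

Fact tmap_zmod : zmod_morphism tmap_fun.
Proof.
move=> u v; apply/esym/eqP.
by rewrite subr_eq -(tens_liftD tmap_balanced) subrK.
Qed.
HB.instance Definition _ := GRing.isZmodMorphism.Build (tens A B) (tens A' B')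
  tmap_fun tmap_zmod.

Fact tmap_monoid : monoid_morphism tmap_fun.
Proof.
split=> [|]; first by rewrite tmap_pure !rmorph1.
elim/tens_ind=> s; elim/tens_ind=> t.
rewrite mulr_suml !raddf_sum mulr_suml; apply: eq_bigr => p _ /=.
rewrite mulr_sumr raddf_sum mulr_sumr; apply: eq_bigr => q _ /=.
by rewrite pureM !tmap_pure pureM !rmorphM.
Qed.
HB.instance Definition _ := GRing.isMonoidMorphism.Build (tens A B)
  (tens A' B') tmap_fun tmap_monoid.

Fact tmap_in c : tmap_fun (alg_in (tensor A B) c) = alg_in (tensor A' B') c.
Proof. by rewrite /= /tens_in tmap_pure hom_in rmorph1. Qed.

Definition tmap : algHom (tensor A B) (tensor A' B') :=
  @AlgHom F (tensor A B) (tensor A' B') tmap_fun tmap_in.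
End TensorMap.

Record grpFunctor (F : fieldType) := GrpFunctor {
  gobj :> comAlg F -> groupType;
  gmap : forall A B : comAlg F, algHom A B -> gobj A -> gobj B;
  gmapM : forall (A B : comAlg F) (f : algHom A B) (x y : gobj A),
    gmap f (x * y)%g = (gmap f x * gmap f y)%g;
  gmap_id : forall (A : comAlg F) (x : gobj A), gmap (hom_id A) x = x;
  gmap_comp : forall (A B C : comAlg F) (g : algHom B C) (f : algHom A B)
    (x : gobj A), gmap (hom_comp g f) x = gmap g (gmap f x) }.

Record grpHom (F : fieldType) (G H : grpFunctor F) := GrpHom {
  ghom :> forall A : comAlg F, G A -> H A;
  ghomM : forall (A : comAlg F) (x y : G A),
    ghom (x * y)%g = (ghom x * ghom y)%g;
  ghom_nat : forall (A B : comAlg F) (f : algHom A B) (x : G A),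
    ghom (gmap f x) = gmap f (ghom x) }.

Section GrpHomOps.
Variables (F : fieldType) (G H K : grpFunctor F).

Fact ghom_compM (g : grpHom H K) (f : grpHom G H) (A : comAlg F) (x y : G A) :
  g A (f A (x * y)%g) = (g A (f A x) * g A (f A y))%g.
Proof. by rewrite !ghomM. Qed.
Fact ghom_comp_nat (g : grpHom H K) (f : grpHom G H) (A B : comAlg F)
    (h : algHom A B) (x : G A) :
  g B (f B (gmap h x)) = gmap h (g A (f A x)).
Proof. by rewrite !ghom_nat. Qed.

Definition ghom_comp (g : grpHom H K) (f : grpHom G H) : grpHom G K :=
  @GrpHom F G K (fun A x => g A (f A x)) (ghom_compM g f) (ghom_comp_nat g f).

Definition mutually_inverse (f : grpHom G H) (g : grpHom H G) : Prop :=
  forall A : comAlg F, cancel (f A) (g A) /\ cancel (g A) (f A).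

Lemma groupMorph1 (A B : groupType) (f : A -> B) :
  (forall x y, f (x * y)%g = (f x * f y)%g) -> f 1%g = 1%g.
Proof. by move=> fM; apply: (@mulIg _ (f 1%g)); rewrite -fM !mul1g. Qed.

Lemma gmap1 (A B : comAlg F) (f : algHom A B) : gmap f (1 : G A)%g = 1%g.
Proof. exact/groupMorph1/gmapM. Qed.
Lemma ghom1 (f : grpHom G H) (A : comAlg F) : f A 1%g = 1%g.
Proof. exact/groupMorph1/ghomM. Qed.
Lemma ghomV (f : grpHom G H) (A : comAlg F) (x : G A) :
  f A x^-1%g = (f A x)^-1%g.
Proof. by apply: (@mulIg _ (f A x)); rewrite -ghomM !mulVg ghom1. Qed.
Lemma gmapV (A B : comAlg F) (f : algHom A B) (x : G A) :
  gmap f x^-1%g = (gmap f x)^-1%g.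
Proof. by apply: (@mulIg _ (gmap f x)); rewrite -gmapM !mulVg gmap1. Qed.
End GrpHomOps.

Section Cohomology.
Variables (F : fieldType) (L : comAlg F).

Definition L2 : comAlg F := tensor L L.
Definition L3 : comAlg F := tensor L2 L.

(* dn_i inserts 1 in slot i of an n-fold tensor. *)
Definition d1_0 : algHom L L2 := tinr L L.
Definition d1_1 : algHom L L2 := tinl L L.
Definition d2_0 : algHom L2 L3 := tmap d1_0 (hom_id L).
Definition d2_1 : algHom L2 L3 := tmap d1_1 (hom_id L).
Definition d2_2 : algHom L2 L3 := tinl L2 L.

Definition is_cocycle (G : grpFunctor F) (phi : G L2) : bool :=
  (gmap d2_0 phi * gmap d2_2 phi)%g == gmap d2_1 phi.

Definition cocycle (G : grpFunctor F) : Type := {phi : G L2 | is_cocycle phi}.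
HB.instance Definition _ (G : grpFunctor F) := Choice.on (cocycle G).

Definition cohomologous (G : grpFunctor F) (phi psi : cocycle G) : bool :=
  `[< exists lam : G L,
        val psi = (gmap d1_0 lam * val phi * (gmap d1_1 lam)^-1)%g >].

Section Quotient.
Variable G : grpFunctor F.

Fact cohom_refl : reflexive (@cohomologous G).
Proof.
by move=> phi; apply/asboolP; exists 1%g; rewrite !gmap1 mul1g invg1 mulg1.
Qed.
Fact cohom_sym : symmetric (@cohomologous G).
Proof.
suff H phi psi : @cohomologous G phi psi -> cohomologous psi phi.
  by move=> phi psi; apply/idP/idP; apply: H.
move=> /asboolP[lam E]; apply/asboolP; exists lam^-1%g.
by rewrite E !gmapV invgK !mulgA mulVg mul1g -mulgA mulVg mulg1.
Qed.
Fact cohom_trans : transitive (@cohomologous G).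
Proof.
move=> psi phi chi /asboolP[lam E] /asboolP[mu E']; apply/asboolP.
by exists (mu * lam)%g; rewrite E' E !gmapM invMg !mulgA.
Qed.

Canonical cohom_equiv :=
  EquivRel (@cohomologous G) cohom_refl cohom_sym cohom_trans.

Definition H1 : Type := {eq_quot cohom_equiv}.

Definition H1_class (phi : cocycle G) : H1 := \pi_({eq_quot cohom_equiv}) phi.

Definition H1_repr (x : H1) : cocycle G :=
  generic_quotient.repr (x : {eq_quot cohom_equiv}).

Lemma H1_reprK x : H1_class (H1_repr x) = x.
Proof. exact: reprK. Qed.

Lemma H1_classP phi psi :
  H1_class phi = H1_class psi <-> cohomologous phi psi.
Proof.
by split=> [/eqP|H]; [|apply/eqP]; rewrite /H1_class piE.
Qed.

Fact is_cocycle1 : is_cocycle (1 : G L2)%g.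
Proof. by rewrite /is_cocycle !gmap1 mulg1. Qed.

Definition H1_point : H1 := H1_class (exist _ 1%g is_cocycle1).
End Quotient.

Section Functoriality.
Variables (G H : grpFunctor F) (f : grpHom G H).

Fact is_cocycle_hom (phi : cocycle G) : is_cocycle (f L2 (val phi)).
Proof.
by rewrite /is_cocycle -!ghom_nat -ghomM (eqP (valP phi)).
Qed.

Definition cocycle_map (phi : cocycle G) : cocycle H :=
  exist _ (f L2 (val phi)) (is_cocycle_hom phi).

Definition H1_map (x : H1 G) : H1 H := H1_class (cocycle_map (H1_repr x)).

Lemma H1_mapE phi : H1_map (H1_class phi) = H1_class (cocycle_map phi).
Proof.
apply/H1_classP; have /H1_classP/asboolP[lam E] := H1_reprK (H1_class phi).
apply/asboolP; exists (f L lam).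
by rewrite /= {1}E !ghomM ghomV !ghom_nat.
Qed.
End Functoriality.
End Cohomology.

Section SL.
Variables (F : fieldType) (n : nat).

Definition slmx (R : comPzRingType) : Type := {M : 'M[R]_n | \det M == 1}.
HB.instance Definition _ (R : comPzRingType) := Choice.on (slmx R).

Section Group.
Variable R : comPzRingType.
Implicit Types x y z : slmx R.

Fact sl_mul_subproof x y : \det (val x *m val y) == 1.
Proof. by rewrite det_mulmx (eqP (valP x)) (eqP (valP y)) mulr1. Qed.
Fact sl_one_subproof : \det (1%:M : 'M[R]_n) == 1.
Proof. by rewrite det1. Qed.
Fact sl_inv_subproof x : \det (\adj (val x)) == 1.
Proof.
have := congr1 determinant (mul_mx_adj (val x)).
by rewrite det_mulmx (eqP (valP x)) mul1r det1 => ->.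
Qed.

Definition sl_mul x y : slmx R :=
  exist (fun M : 'M_n => \det M == 1) _ (sl_mul_subproof x y).
Definition sl_one : slmx R :=
  exist (fun M : 'M_n => \det M == 1) _ sl_one_subproof.
Definition sl_inv x : slmx R :=
  exist (fun M : 'M_n => \det M == 1) _ (sl_inv_subproof x).

Fact sl_mulA : associative sl_mul.
Proof. by move=> x y z; apply: val_inj; rewrite /= mulmxA. Qed.
Fact sl_mul1 : left_id sl_one sl_mul.
Proof. by move=> x; apply: val_inj; rewrite /= mul1mx. Qed.
Fact sl_mulr1 : right_id sl_one sl_mul.
Proof. by move=> x; apply: val_inj; rewrite /= mulmx1. Qed.
Fact sl_mulV : left_inverse sl_one sl_inv sl_mul.
Proof.
by move=> x; apply: val_inj; rewrite /= mul_adj_mx (eqP (valP x)).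
Qed.
Fact sl_mulrV : right_inverse sl_one sl_inv sl_mul.
Proof.
by move=> x; apply: val_inj; rewrite /= mul_mx_adj (eqP (valP x)).
Qed.
HB.instance Definition _ :=
  isGroup.Build (slmx R) sl_mulA sl_mul1 sl_mulr1 sl_mulV sl_mulrV.
End Group.

Fact sl_map_subproof (A B : comAlg F) (f : algHom A B) (x : slmx A) :
  \det (map_mx f (val x)) == 1.
Proof. by rewrite det_map_mx (eqP (valP x)) rmorph1. Qed.
Definition sl_map (A B : comAlg F) (f : algHom A B) (x : slmx A) : slmx B :=
  exist (fun M : 'M_n => \det M == 1) _ (sl_map_subproof f x).

Fact sl_mapM (A B : comAlg F) (f : algHom A B) (x y : slmx A) :
  sl_map f (x * y)%g = (sl_map f x * sl_map f y)%g.
Proof. by apply: val_inj; rewrite /= map_mxM. Qed.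
Fact sl_map_id (A : comAlg F) (x : slmx A) : sl_map (hom_id A) x = x.
Proof. by apply: val_inj; apply/matrixP => i j; rewrite !mxE. Qed.
Fact sl_map_comp (A B C : comAlg F) (g : algHom B C) (f : algHom A B)
  (x : slmx A) : sl_map (hom_comp g f) x = sl_map g (sl_map f x).
Proof. by apply: val_inj; apply/matrixP => i j; rewrite !mxE. Qed.

Definition SLn : grpFunctor F :=
  @GrpFunctor F (fun A => slmx A : groupType) sl_map sl_mapM sl_map_id
    sl_map_comp.
End SL.

Section Constant.
Variables (F : fieldType) (gT : finGroupType).

(* The R-points of the constant group scheme are the algebra maps from the
   coordinate algebra F^gT to R, i.e. the families of orthogonal idempotents
   of R with sum 1 indexed by gT. An element g of gT is the family equal to 1
   at g and to 0 elsewhere. *)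
Definition is_point (R : comPzRingType) (e : {ffun gT -> R}) : bool :=
  [forall g, forall h, e g * e h == (if g == h then e g else 0)] &&
  (\sum_g e g == 1).

Definition cpoint (R : comPzRingType) : Type := {e : {ffun gT -> R} | is_point e}.
HB.instance Definition _ (R : comPzRingType) := Choice.on (cpoint R).

Section Group.
Variable R : comPzRingType.
Implicit Types x y z : cpoint R.

Lemma is_pointP (e : {ffun gT -> R}) :
  reflect ((forall g h, e g * e h = if g == h then e g else 0) /\
           \sum_g e g = 1) (is_point e).
Proof.
apply: (iffP andP) => [[H /eqP E]|[H E]]; split=> //.
- by move=> g h; apply/eqP; move/forallP/(_ g)/forallP: H.
- by apply/forallP => g; apply/forallP => h; apply/eqP.
- exact/eqP.
Qed.

Lemma cpoint_orth x g h : val x g * val x h = if g == h then val x g else 0.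
Proof. by case/is_pointP: (valP x). Qed.
Lemma cpoint_sum x : \sum_g val x g = 1.
Proof. by case/is_pointP: (valP x). Qed.

Definition cmul_fun x y : {ffun gT -> R} :=
  [ffun g => \sum_h val x h * val y (h^-1 * g)%g].
Definition cone_fun : {ffun gT -> R} := [ffun g => (g == 1%g)%:R].
Definition cinv_fun x : {ffun gT -> R} := [ffun g => val x g^-1%g].

Fact cmul_subproof x y : is_point (cmul_fun x y).
Proof.
apply/is_pointP; split=> [g h|].
  rewrite !ffunE mulr_suml.
  transitivity (\sum_k val x k * (val y (k^-1 * g)%g * val y (k^-1 * h)%g)).
    apply: eq_bigr => k _; rewrite mulr_sumr (bigD1 k) //= big1 ?addr0.
      by rewrite mulrACA cpoint_orth eqxx.
    move=> l lk; rewrite mulrACA cpoint_orth eq_sym (negPf lk).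
    by rewrite mul0r.
  case: eqP => [->|/eqP gh].
    by apply: eq_bigr => k _; rewrite cpoint_orth eqxx.
  apply: big1 => k _; rewrite cpoint_orth.
  by rewrite (inj_eq (mulgI _)) (negPf gh) mulr0.
transitivity (\sum_g \sum_h val x h * val y (h^-1 * g)%g).
  by apply: eq_bigr => g _; rewrite ffunE.
rewrite exchange_big -[RHS](cpoint_sum x); apply: eq_bigr => h _.
rewrite -mulr_sumr -[RHS]mulr1 -(cpoint_sum y); congr (_ * _).
by rewrite [RHS](reindex_inj (mulgI h^-1%g)).
Qed.
Fact cone_subproof : is_point cone_fun.
Proof.
apply/is_pointP; split=> [g h|]; last first.
  rewrite (bigD1 1%g) //= ffunE eqxx big1 ?addr0 // => g gn1.
  by rewrite ffunE (negPf gn1).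
rewrite !ffunE; case: (eqVneq g h) => [->|gh].
  by case: eqP; rewrite ?mulr1 ?mulr0.
case: (eqVneq g 1%g) gh => [->|_ _]; last by rewrite mul0r.
by rewrite eq_sym => /negPf->; rewrite mulr0.
Qed.
Fact cinv_subproof x : is_point (cinv_fun x).
Proof.
apply/is_pointP; split=> [g h|].
  by rewrite !ffunE cpoint_orth (inj_eq invg_inj).
rewrite -[RHS](cpoint_sum x) [RHS](reindex_inj invg_inj).
by apply: eq_bigr => g _; rewrite ffunE.
Qed.

Definition cmul x y : cpoint R := exist (@is_point R) _ (cmul_subproof x y).
Definition cone : cpoint R := exist (@is_point R) _ cone_subproof.
Definition cinv x : cpoint R := exist (@is_point R) _ (cinv_subproof x).

Fact cmulA : associative cmul.
Proof.
move=> x y z; apply: val_inj; apply/ffunP => g; rewrite !ffunE /=.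
under eq_bigr do rewrite ffunE mulr_sumr.
under [RHS]eq_bigr do rewrite ffunE mulr_suml.
rewrite [RHS]exchange_big; apply: eq_bigr => h _ /=.
rewrite [RHS](reindex_inj (mulgI h)); apply: eq_bigr => k _ /=.
by rewrite mulrA mulKg invMg mulgA.
Qed.
Fact cmul1 : left_id cone cmul.
Proof.
move=> x; apply: val_inj; apply/ffunP => g; rewrite !ffunE /=.
rewrite (bigD1 1%g) //= ffunE eqxx mul1r invg1 mul1g big1 ?addr0 // => h hn1.
by rewrite ffunE (negPf hn1) mul0r.
Qed.
Fact cmulr1 : right_id cone cmul.
Proof.
move=> x; apply: val_inj; apply/ffunP => g; rewrite !ffunE /=.
rewrite (bigD1 g) //= ffunE mulVg eqxx mulr1 big1 ?addr0 // => h hg.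
by rewrite ffunE -eq_mulVg1 (negPf hg) mulr0.
Qed.
Lemma cpoint_delta x g :
  \sum_h val x h * val x (h * g)%g = (g == 1%g)%:R.
Proof.
transitivity (\sum_h (if g == 1%g then val x h else 0)).
  apply: eq_bigr => h _; rewrite cpoint_orth.
  by rewrite -[X in X == _]mulg1 (inj_eq (mulgI _)) eq_sym.
by case: eqP => _; [exact: cpoint_sum | rewrite big1].
Qed.
Fact cmulV : left_inverse cone cinv cmul.
Proof.
move=> x; apply: val_inj; apply/ffunP => g; rewrite !ffunE /=.
rewrite -(cpoint_delta x) [RHS](reindex_inj invg_inj).
by apply: eq_bigr => h _; rewrite ffunE.
Qed.
Fact cmulrV : right_inverse cone cinv cmul.
Proof.
move=> x; apply: val_inj; apply/ffunP => g; rewrite !ffunE /=.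
transitivity (\sum_h (if g == 1%g then val x h else 0)).
  apply: eq_bigr => h _; rewrite ffunE cpoint_orth invMg invgK.
  by rewrite -[X in X == _]mul1g (inj_eq (mulIg _)) (eq_sym 1%g) invg_eq1.
by case: eqP => _; [exact: cpoint_sum | rewrite big1].
Qed.
HB.instance Definition _ :=
  isGroup.Build (cpoint R) cmulA cmul1 cmulr1 cmulV cmulrV.
End Group.

Fact cmap_subproof (A B : comAlg F) (f : algHom A B) (x : cpoint A) :
  is_point [ffun g => f (val x g)].
Proof.
apply/is_pointP; split=> [g h|].
  by rewrite !ffunE -rmorphM cpoint_orth; case: ifP; rewrite ?rmorph0.
under eq_bigr do rewrite ffunE.
by rewrite -rmorph_sum cpoint_sum rmorph1.
Qed.
Definition cmap (A B : comAlg F) (f : algHom A B) (x : cpoint A) : cpoint B :=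
  exist (@is_point B) _ (cmap_subproof f x).

Fact cmapM (A B : comAlg F) (f : algHom A B) (x y : cpoint A) :
  cmap f (x * y)%g = (cmap f x * cmap f y)%g.
Proof.
apply: val_inj; apply/ffunP => g; rewrite !ffunE rmorph_sum.
by apply: eq_bigr => h _; rewrite !ffunE rmorphM.
Qed.
Fact cmap_id (A : comAlg F) (x : cpoint A) : cmap (hom_id A) x = x.
Proof. by apply: val_inj; apply/ffunP => g; rewrite !ffunE. Qed.
Fact cmap_comp (A B C : comAlg F) (g : algHom B C) (f : algHom A B)
  (x : cpoint A) : cmap (hom_comp g f) x = cmap g (cmap f x).
Proof. by apply: val_inj; apply/ffunP => h; rewrite !ffunE. Qed.

Definition constG : grpFunctor F :=
  @GrpFunctor F (fun A => cpoint A : groupType) cmap cmapM cmap_id cmap_comp.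
End Constant.

Section Product.
Variables (F : fieldType) (G H : grpFunctor F).

Definition pgrp (A : comAlg F) : Type := (G A * H A)%type.
HB.instance Definition _ A := Choice.on (pgrp A).

Section Group.
Variable A : comAlg F.
Implicit Types x y : pgrp A.
Definition pmul x y : pgrp A := (x.1 * y.1, x.2 * y.2)%g.
Definition pone : pgrp A := (1, 1)%g.
Definition pinvg x : pgrp A := (x.1^-1, x.2^-1)%g.
Fact pmulA : associative pmul.
Proof. by move=> x y z; rewrite /pmul !mulgA. Qed.
Fact pmul1 : left_id pone pmul.
Proof. by case=> x y; rewrite /pmul !mul1g. Qed.
Fact pmulr1 : right_id pone pmul.
Proof. by case=> x y; rewrite /pmul !mulg1. Qed.
Fact pmulV : left_inverse pone pinvg pmul.
Proof. by case=> x y; rewrite /pmul !mulVg. Qed.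
Fact pmulrV : right_inverse pone pinvg pmul.
Proof. by case=> x y; rewrite /pmul !mulgV. Qed.
HB.instance Definition _ :=
  isGroup.Build (pgrp A) pmulA pmul1 pmulr1 pmulV pmulrV.
End Group.

Definition prodG_map (A B : comAlg F) (f : algHom A B) (x : pgrp A) : pgrp B :=
  (gmap f x.1, gmap f x.2).
Fact prodG_mapM (A B : comAlg F) (f : algHom A B) (x y : pgrp A) :
  prodG_map f (x * y)%g = (prodG_map f x * prodG_map f y)%g.
Proof. by rewrite /prodG_map !gmapM. Qed.
Fact prodG_map_id (A : comAlg F) (x : pgrp A) : prodG_map (hom_id A) x = x.
Proof. by case: x => x y; rewrite /prodG_map !gmap_id. Qed.
Fact prodG_map_comp (A B C : comAlg F) (g : algHom B C) (f : algHom A B)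
  (x : pgrp A) : prodG_map (hom_comp g f) x = prodG_map g (prodG_map f x).
Proof. by rewrite /prodG_map !gmap_comp. Qed.

Definition prodG : grpFunctor F :=
  @GrpFunctor F (fun A => pgrp A : groupType) prodG_map prodG_mapM prodG_map_id prodG_map_comp.
End Product.

Record grpAction (F : fieldType) (H N : grpFunctor F) := GrpAction {
  gact : forall A : comAlg F, H A -> N A -> N A;
  gact_mor : forall (A : comAlg F) (h : H A) (x y : N A),
    gact h (x * y)%g = (gact h x * gact h y)%g;
  gact1 : forall (A : comAlg F) (x : N A), gact (1%g : H A) x = x;
  gactM : forall (A : comAlg F) (h k : H A) (x : N A),
    gact (h * k)%g x = gact h (gact k x);
  gact_nat : forall (A B : comAlg F) (f : algHom A B) (h : H A) (x : N A),
    gact (gmap f h) (gmap f x) = gmap f (gact h x) }.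

Section Semidirect.
Variables (F : fieldType) (H N : grpFunctor F) (act : grpAction H N).

Definition sgrp (_ : grpAction H N) (A : comAlg F) : Type := (N A * H A)%type.
HB.instance Definition _ A := Choice.on (sgrp act A).

Section Group.
Variable A : comAlg F.
Implicit Types x y : sgrp act A.
Definition smulg x y : sgrp act A := (x.1 * gact act x.2 y.1, x.2 * y.2)%g.
Definition soneg : sgrp act A := (1, 1)%g.
Definition sinvg x : sgrp act A := (gact act x.2^-1 x.1^-1, x.2^-1)%g.
Lemma gact_one (h : H A) : gact act h (1 : N A)%g = 1%g.
Proof. exact/groupMorph1/gact_mor. Qed.
Fact smulgA : associative smulg.
Proof. by move=> x y z; rewrite /smulg /= gact_mor gactM !mulgA. Qed.
Fact smulg1 : left_id soneg smulg.
Proof. by case=> x y; rewrite /smulg /= gact1 !mul1g. Qed.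
Fact smulgr1 : right_id soneg smulg.
Proof. by case=> x y; rewrite /smulg /= gact_one !mulg1. Qed.
Fact smulgV : left_inverse soneg sinvg smulg.
Proof.
by case=> x y; rewrite /smulg /= -gact_mor !mulVg gact_one.
Qed.
Fact smulgrV : right_inverse soneg sinvg smulg.
Proof. by case=> x y; rewrite /smulg /= -gactM !mulgV gact1 mulgV. Qed.
HB.instance Definition _ :=
  isGroup.Build (sgrp act A) smulgA smulg1 smulgr1 smulgV smulgrV.
End Group.

Definition smap (A B : comAlg F) (f : algHom A B) (x : sgrp act A) :
  sgrp act B := (gmap f x.1, gmap f x.2).
Fact smapM (A B : comAlg F) (f : algHom A B) (x y : sgrp act A) :
  smap f (x * y)%g = (smap f x * smap f y)%g.
Proof. by rewrite /smap !gmapM -gact_nat. Qed.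
Fact smap_id (A : comAlg F) (x : sgrp act A) : smap (hom_id A) x = x.
Proof. by case: x => x y; rewrite /smap !gmap_id. Qed.
Fact smap_comp (A B C : comAlg F) (g : algHom B C) (f : algHom A B)
  (x : sgrp act A) : smap (hom_comp g f) x = smap g (smap f x).
Proof. by rewrite /smap !gmap_comp. Qed.

Definition sdprodG : grpFunctor F :=
  @GrpFunctor F (fun A => sgrp act A : groupType) smap smapM smap_id smap_comp.

Definition sdproj : grpHom sdprodG H :=
  @GrpHom F sdprodG H (fun A x => x.2) (fun _ _ _ => erefl)
    (fun _ _ _ _ => erefl).
End Semidirect.

Section FreeModule.
Variable R : comPzRingType.

Definition fmod (B : finType) : lmodType R := {ffun B -> R^o}.

Definition vec (B : finType) (g : B -> R) : fmod B := [ffun b => g b].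
Definition ebas (B : finType) (b : B) : fmod B := vec (fun c => (c == b)%:R).

Definition coef (B : finType) (v : fmod B) (b : B) : R := (v : {ffun _ -> _}) b.

(* The linear map with prescribed values on the basis. *)
Definition lext (B C : finType) (m : B -> fmod C) (v : fmod B) : fmod C :=
  \sum_b coef v b *: m b.

Lemma fmodP (B : finType) (u v : fmod B) : coef u =1 coef v <-> u = v.
Proof. by split=> [H|->] //; apply/ffunP. Qed.

Lemma coef_vec (B : finType) (g : B -> R) b : coef (vec g) b = g b.
Proof. by rewrite /coef ffunE. Qed.
Lemma coef_ebas (B : finType) (b c : B) : coef (ebas b) c = (c == b)%:R.
Proof. exact: coef_vec. Qed.
Lemma coefD (B : finType) (u v : fmod B) b :
  coef (u + v) b = coef u b + coef v b.
Proof. by rewrite /coef ffunE. Qed.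
Lemma coefB (B : finType) (u v : fmod B) b :
  coef (u - v) b = coef u b - coef v b.
Proof. by rewrite /coef !ffunE. Qed.
Lemma coef0 (B : finType) (b : B) : coef 0 b = 0.
Proof. by rewrite /coef ffunE. Qed.
Lemma coefZ (B : finType) a (u : fmod B) b : coef (a *: u) b = a * coef u b.
Proof. by rewrite /coef ffunE. Qed.
Lemma coef_sum (B : finType) I (r : seq I) (P : pred I) (G : I -> fmod B) b :
  coef (\sum_(i <- r | P i) G i) b = \sum_(i <- r | P i) coef (G i) b.
Proof. by elim/big_rec2: _ => [|i y x _ <-]; rewrite ?coef0 ?coefD. Qed.

Lemma coef_lext (B C : finType) (m : B -> fmod C) v c :
  coef (lext m v) c = \sum_b coef v b * coef (m b) c.
Proof. by rewrite coef_sum; apply: eq_bigr => b _; rewrite coefZ. Qed.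

Lemma lext_linear (B C : finType) (m : B -> fmod C) : linear (lext m).
Proof.
move=> a u v; rewrite /lext scaler_sumr -big_split; apply: eq_bigr => b _ /=.
by rewrite coefD coefZ scalerDl scalerA.
Qed.

Lemma linear_zero (B C : finType) (f : fmod B -> fmod C) :
  linear f -> f 0 = 0.
Proof.
move=> fL; have := fL 1 0 0; rewrite !scale1r addr0 => E.
by apply: (@addrI _ (f 0)); rewrite -E addr0.
Qed.

Lemma linear_lext (B C : finType) (f : fmod B -> fmod C) :
  linear f -> f =1 lext (fun b => f (ebas b)).
Proof.
move=> fL v; have f0 := linear_zero fL.
have {1}-> : v = \sum_b coef v b *: ebas b.
  apply/fmodP => c; rewrite coef_sum (bigD1 c) //= big1 ?addr0.
    by rewrite coefZ coef_ebas eqxx mulr1.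
  by move=> b bc; rewrite coefZ coef_ebas eq_sym (negPf bc) mulr0.
rewrite /lext; elim: (index_enum B) => [|b r IHr]; first by rewrite !big_nil.
by rewrite !big_cons fL IHr.
Qed.

Lemma lext_ebas (B C : finType) (m : B -> fmod C) b : lext m (ebas b) = m b.
Proof.
rewrite /lext (bigD1 b) //= coef_ebas eqxx scale1r big1 ?addr0 // => c cb.
by rewrite coef_ebas (negPf cb) scale0r.
Qed.
End FreeModule.

Definition bchange (R S : comPzRingType) (f : {rmorphism R -> S})
  (B : finType) (v : fmod R B) : fmod S B := vec (fun b => f (coef v b)).

(* A superalgebra with a chosen finite homogeneous basis: the parity of the
   basis elements and the products of pairs of basis elements. *)
Record superalg (F : fieldType) := Superalg {
  sa_basis : finType;
  sa_par : sa_basis -> bool;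
  sa_mul : sa_basis -> sa_basis -> fmod F sa_basis;
  sa_graded : forall x y z,
    coef (sa_mul x y) z != 0 -> sa_par z = sa_par x (+) sa_par y }.

Section Scalars.
Variables (F : fieldType) (A : superalg F).

(* A (x)_F R is the free R-module on the basis of A. *)
Definition sext (R : comAlg F) : lmodType R := fmod R (sa_basis A).

Definition smul (R : comAlg F) (u v : sext R) : sext R :=
  \sum_x \sum_y (coef u x * coef v y) *: bchange (alg_in R) (sa_mul x y).

Definition homogeneous (R : comAlg F) (p : bool) (u : sext R) : Prop :=
  forall b, sa_par b != p -> coef u b = 0.

Definition is_saut (R : comAlg F) (phi : sext R -> sext R) : Prop :=
  [/\ linear phi,
      bijective phi,
      (forall u v, phi (smul u v) = smul (phi u) (phi v))
    & (forall p u, homogeneous p u -> homogeneous p (phi u))].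

Definition saut (R : comAlg F) : Type :=
  {phi : sext R -> sext R | `[< is_saut phi >]}.
HB.instance Definition _ R := Choice.on (saut R).

Definition mk_saut (R : comAlg F) (phi : sext R -> sext R) (h : is_saut phi) :
  saut R := exist (fun phi => `[< is_saut phi >]) phi (asboolT h).

Lemma sautP (R : comAlg F) (phi : saut R) : is_saut (val phi).
Proof. exact: (asboolW (valP phi)). Qed.

Lemma smul_suml (R : comAlg F) I (r : seq I) (c : I -> R) (G : I -> sext R) v :
  smul (\sum_(i <- r) c i *: G i) v = \sum_(i <- r) c i *: smul (G i) v.
Proof.
rewrite /smul; under [RHS]eq_bigr do rewrite scaler_sumr.
rewrite [RHS]exchange_big; apply: eq_bigr => x _ /=.
under [RHS]eq_bigr do rewrite scaler_sumr.
rewrite [RHS]exchange_big; apply: eq_bigr => y _ /=.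
rewrite coef_sum mulr_suml scaler_suml; apply: eq_bigr => i _.
by rewrite coefZ scalerA mulrA.
Qed.

Lemma smul_sumr (R : comAlg F) I (r : seq I) (c : I -> R) (G : I -> sext R) v :
  smul v (\sum_(i <- r) c i *: G i) = \sum_(i <- r) c i *: smul v (G i).
Proof.
rewrite /smul; under [RHS]eq_bigr do rewrite scaler_sumr.
rewrite [RHS]exchange_big; apply: eq_bigr => x _ /=.
under [RHS]eq_bigr do rewrite scaler_sumr.
rewrite [RHS]exchange_big; apply: eq_bigr => y _ /=.
rewrite coef_sum mulr_sumr scaler_suml; apply: eq_bigr => i _.
by rewrite coefZ scalerA mulrCA.
Qed.

Lemma smul_ebas (R : comAlg F) x y :
  smul (ebas R x : sext R) (ebas R y) = bchange (alg_in R) (sa_mul x y).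
Proof.
rewrite /smul (bigD1 x) //= (bigD1 y) //= !coef_ebas !eqxx mulr1 scale1r.
rewrite !big1 ?addr0 // => [z zx|z zy].
  by apply: big1 => t _; rewrite coef_ebas (negPf zx) mul0r scale0r.
by rewrite !coef_ebas (negPf zy) mulr0 scale0r.
Qed.

Lemma lext_sum (R : comAlg F) (B C : finType) (m : B -> fmod R C)
    I (r : seq I) (c : I -> R) (G : I -> fmod R B) :
  lext m (\sum_(i <- r) c i *: G i) = \sum_(i <- r) c i *: lext m (G i).
Proof.
elim: r => [|i r IHr].
  by rewrite !big_nil; apply: big1 => b _; rewrite coef0 scale0r.
by rewrite !big_cons lext_linear IHr.
Qed.

Lemma lext_morph (R : comAlg F) (m : sa_basis A -> sext R) :
  (forall x y, lext m (bchange (alg_in R) (sa_mul x y)) = smul (m x) (m y)) ->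
  forall u v, lext m (smul u v) = smul (lext m u) (lext m v).
Proof.
move=> mM u v; rewrite {2 3}/lext smul_suml {1}/smul.
transitivity (\sum_x coef u x *: lext m
   (\sum_y coef v y *: bchange (alg_in R) (sa_mul x y))).
  rewrite -lext_sum; congr (lext m _); apply: eq_bigr => x _.
  by rewrite scaler_sumr; apply: eq_bigr => y _; rewrite scalerA.
apply: eq_bigr => x _; rewrite lext_sum smul_sumr.
by congr (_ *: _); apply: eq_bigr => y _; rewrite mM.
Qed.

Lemma lext_homogeneous (R : comAlg F) (m : sa_basis A -> sext R) :
  (forall x, homogeneous (sa_par x) (m x)) ->
  forall p u, homogeneous p u -> homogeneous p (lext m u).
Proof.
move=> mH p u uH b bp; rewrite coef_lext; apply: big1 => x _.
have [xp|xp] := eqVneq (sa_par x) p; last by rewrite uH ?mul0r.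
by rewrite (mH x) ?mulr0 // xp.
Qed.

Lemma saut_ext (R : comAlg F) (phi psi : saut R) :
  (forall b, val phi (ebas R b) = val psi (ebas R b)) -> phi = psi.
Proof.
move=> H; apply: val_inj; apply: funext => v.
have [pL _ _ _] := sautP phi; have [qL _ _ _] := sautP psi.
rewrite (linear_lext pL) (linear_lext qL).
by apply: eq_bigr => b _; rewrite H.
Qed.

Section Group.
Variable R : comAlg F.
Implicit Types phi psi : saut R.

Fact saut_mul_subproof phi psi : is_saut (val phi \o val psi).
Proof.
have [pL pB pM pH] := sautP phi; have [qL qB qM qH] := sautP psi.
split=> [a u v||u v|p u uH] /=.
- by rewrite qL pL.
- exact: bij_comp.
- by rewrite qM pM.
- exact/pH/qH.
Qed.
Definition saut_mul phi psi : saut R := mk_saut (saut_mul_subproof phi psi).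

Fact saut_one_subproof : is_saut (@id (sext R)).
Proof. by split=> //; exists id. Qed.
Definition saut_one : saut R := mk_saut saut_one_subproof.

Fact saut_inv_ex phi : exists g, cancel (val phi) g /\ cancel g (val phi).
Proof. by have [_ [g K K'] _ _] := sautP phi; exists g. Qed.
Definition saut_inv_fun phi : sext R -> sext R :=
  projT1 (cid (saut_inv_ex phi)).

Lemma saut_inv_funK phi : cancel (saut_inv_fun phi) (val phi).
Proof. by rewrite /saut_inv_fun; case: cid => g []. Qed.
Lemma saut_funK phi : cancel (val phi) (saut_inv_fun phi).
Proof. by rewrite /saut_inv_fun; case: cid => g []. Qed.

Fact saut_inv_subproof phi : is_saut (saut_inv_fun phi).
Proof.
have K := saut_inv_funK phi; have K' := saut_funK phi.
have [pL pB pM pH] := sautP phi; have pI := bij_inj pB.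
split=> [a u v||u v|p u uH].
- by apply: pI; rewrite pL !K.
- by exists (val phi).
- by apply: pI; rewrite pM !K.
have [v0 [v1 [vE v0H v1H]]] : exists v0 v1 : sext R,
    [/\ saut_inv_fun phi u = v0 + v1, homogeneous p v0
      & homogeneous (~~ p) v1].
  exists (vec (fun b => if sa_par b == p then coef (saut_inv_fun phi u) b
                        else 0)).
  exists (vec (fun b => if sa_par b == p then 0
                        else coef (saut_inv_fun phi u) b)).
  split=> [|b bp|b bp]; last 2 first.
  - by rewrite coef_vec (negPf bp).
  - by rewrite coef_vec; move: bp; case: (sa_par b) p {uH} => [] [].
  apply/fmodP => b; rewrite coefD !coef_vec.
  by case: ifP; rewrite ?addr0 ?add0r.
suff v10 : v1 = 0 by rewrite vE v10 addr0.
apply: pI.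
rewrite (linear_zero pL); apply/fmodP => b; rewrite coef0.
have [bp|bp] := eqVneq (sa_par b) p; last first.
  have : coef u b = 0 by exact: uH.
  rewrite -{1}(K u) vE -[v0]scale1r pL scale1r coefD.
  by rewrite (pH _ _ v0H) ?add0r.
by apply: (pH _ _ v1H); rewrite bp; case: (p).
Qed.
Definition saut_inv phi : saut R := mk_saut (saut_inv_subproof phi).

Fact saut_mulA : associative saut_mul.
Proof. by move=> phi psi chi; apply: val_inj. Qed.
Fact saut_mul1 : left_id saut_one saut_mul.
Proof. by move=> phi; apply: val_inj. Qed.
Fact saut_mulr1 : right_id saut_one saut_mul.
Proof. by move=> phi; apply: val_inj. Qed.
Fact saut_mulV : left_inverse saut_one saut_inv saut_mul.
Proof. by move=> phi; apply: val_inj; apply: funext; apply: saut_funK. Qed.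
Fact saut_mulrV : right_inverse saut_one saut_inv saut_mul.
Proof. by move=> phi; apply: val_inj; apply: funext; apply: saut_inv_funK. Qed.
HB.instance Definition _ :=
  isGroup.Build (saut R) saut_mulA saut_mul1 saut_mulr1 saut_mulV saut_mulrV.
End Group.

Section BaseChange.
Variables (R S : comAlg F) (f : algHom R S).

(* The S-linear extension of an R-linear map. *)
Definition lchange (phi : sext R -> sext R) : sext S -> sext S :=
  lext (fun b => bchange f (phi (ebas R b)) : sext S).

Lemma lchange_bchange phi v :
  linear phi -> lchange phi (bchange f v) = bchange f (phi v).
Proof.
move=> pL; rewrite [in RHS](linear_lext pL); apply/fmodP => c.
rewrite /lchange coef_lext coef_vec coef_lext rmorph_sum.
by apply: eq_bigr => b _; rewrite !coef_vec rmorphM.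
Qed.

Lemma bchange_smul u v :
  bchange f (smul u v) = smul (bchange f u : sext S) (bchange f v).
Proof.
apply/fmodP => c; rewrite coef_vec /smul !coef_sum rmorph_sum.
apply: eq_bigr => x _; rewrite !coef_sum rmorph_sum.
by apply: eq_bigr => y _; rewrite !coefZ !coef_vec !rmorphM hom_in.
Qed.

Lemma lchange_comp phi psi : linear phi -> linear psi ->
  lchange (phi \o psi) =1 lchange phi \o lchange psi.
Proof.
move=> pL qL v; rewrite /= {2}/lchange /lext [RHS]lext_sum.
by apply: eq_bigr => b _; rewrite -/(lchange phi _) lchange_bchange.
Qed.

Lemma lchange_id phi : phi =1 id -> lchange phi =1 id.
Proof.
move=> pE v; apply/fmodP => c; rewrite coef_lext (bigD1 c) //=.
rewrite pE coef_vec coef_ebas eqxx rmorph1 mulr1 big1 ?addr0 // => b bc.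
by rewrite pE coef_vec coef_ebas eq_sym (negPf bc) rmorph0 mulr0.
Qed.

Fact saut_map_subproof (phi : saut R) : is_saut (lchange (val phi)).
Proof.
have [pL pB pM pH] := sautP phi.
split; first exact: lext_linear.
- exists (lchange (val (saut_inv phi))) => v.
    have [qL _ _ _] := sautP (saut_inv phi).
    by rewrite -[LHS]lchange_comp //; apply: lchange_id; apply: saut_funK.
  have [qL _ _ _] := sautP (saut_inv phi).
  by rewrite -[LHS]lchange_comp //; apply: lchange_id; apply: saut_inv_funK.
- apply: lext_morph => x y; rewrite -bchange_smul -pM smul_ebas.
  rewrite -lchange_bchange //; congr (lext _ _).
  by apply/fmodP => c; rewrite !coef_vec hom_in.
- apply: lext_homogeneous => x b bx; rewrite coef_vec.
  rewrite (pH (sa_par x)) ?rmorph0 // => c cx.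
  by rewrite coef_ebas; case: (c =P x) cx => [->|//]; rewrite eqxx.
Qed.
Definition saut_map (phi : saut R) : saut S := mk_saut (saut_map_subproof phi).

Fact saut_mapM (phi psi : saut R) :
  saut_map (phi * psi)%g = (saut_map phi * saut_map psi)%g.
Proof.
have [pL _ _ _] := sautP phi; have [qL _ _ _] := sautP psi.
by apply: val_inj; apply: funext; apply: lchange_comp.
Qed.
End BaseChange.

Fact saut_map_id (R : comAlg F) (phi : saut R) : saut_map (hom_id R) phi = phi.
Proof.
apply: saut_ext => b; rewrite /= /lchange lext_ebas.
by apply/fmodP => c; rewrite coef_vec.
Qed.
Fact saut_map_comp (R S T : comAlg F) (g : algHom S T) (f : algHom R S)
  (phi : saut R) : saut_map (hom_comp g f) phi = saut_map g (saut_map f phi).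
Proof.
apply: saut_ext => b; rewrite /= /lchange !lext_ebas.
by apply/fmodP => c; rewrite !coef_vec.
Qed.

Definition AutG : grpFunctor F :=
  @GrpFunctor F (fun R => saut R : groupType) saut_map saut_mapM saut_map_id
    saut_map_comp.
End Scalars.

(* C_2(R) acts on (SL_2 x SL_2)(R) by exchanging the factors over the component
   of R where e 1 = 1. *)
Section Swap.
Variable F : fieldType.

Definition C2 : grpFunctor F := constG F 'Z_2.
Definition SL2xSL2 : grpFunctor F := prodG (SLn F 2) (SLn F 2).

Lemma Z2_sum (V : nmodType) (G : 'Z_2 -> V) : \sum_h G h = G 0 + G 1.
Proof.
by rewrite !big_ord_recl big_ord0 addr0; congr (G _ + G _); apply: val_inj.
Qed.

Section Points.
Variable R : comPzRingType.
Implicit Types e : cpoint 'Z_2 R.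

Lemma pt_sqr e i : val e i * val e i = val e i.
Proof. by rewrite cpoint_orth eqxx. Qed.
Lemma pt01 e : val e 0 * val e 1 = 0.
Proof. by rewrite cpoint_orth. Qed.
Lemma pt10 e : val e 1 * val e 0 = 0.
Proof. by rewrite cpoint_orth. Qed.
Lemma pt_sum e : val e 0 + val e 1 = 1.
Proof. by rewrite -Z2_sum cpoint_sum. Qed.
Lemma pt_mul0 e e' :
  val (e * e')%g 0 = val e 0 * val e' 0 + val e 1 * val e' 1.
Proof.
by rewrite ffunE Z2_sum; congr (_ * val e' _ + _ * val e' _); apply: val_inj.
Qed.
Lemma pt_mul1 e e' :
  val (e * e')%g 1 = val e 0 * val e' 1 + val e 1 * val e' 0.
Proof.
by rewrite ffunE Z2_sum; congr (_ * val e' _ + _ * val e' _); apply: val_inj.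
Qed.
Lemma pt_one :
  (val (1%g : cpoint 'Z_2 R) 0 = 1) * (val (1%g : cpoint 'Z_2 R) 1 = 0).
Proof. by split; rewrite ffunE. Qed.

Lemma det2 (f : 'M[R]_2) : \det f = f 0 0 * f 1 1 - f 0 1 * f 1 0.
Proof.
rewrite (expand_det_row _ 0) !big_ord_recl big_ord0 addr0 /cofactor.
rewrite !det_mx11 !mxE /= expr0 mul1r expr1 mulN1r mulrN.
by congr (_ * f _ _ - f _ _ * f _ _); apply: val_inj.
Qed.

Lemma sl_det (f : slmx 2 R) :
  val f 0 0 * val f 1 1 - val f 0 1 * val f 1 0 = 1.
Proof. by rewrite -det2 (eqP (valP f)). Qed.

Fact mix_subproof e (f g : slmx 2 R) :
  \det (val e 0 *: val f + val e 1 *: val g) == 1.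
Proof.
apply/eqP; rewrite det2 !mxE.
have Ef := sl_det f; have Eg := sl_det g.
move: (pt_sqr e 0) (pt_sqr e 1) (pt01 e) (pt_sum e).
move: (val e 0) (val e 1) (val f) (val g) Ef Eg => a b {}f {}g Ef Eg.
move=> aa bb ab s.
transitivity (a * a * (f 0 0 * f 1 1 - f 0 1 * f 1 0)
  + b * b * (g 0 0 * g 1 1 - g 0 1 * g 1 0)
  + a * b * (f 0 0 * g 1 1 + g 0 0 * f 1 1 - f 0 1 * g 1 0 - g 0 1 * f 1 0)).
  by ring.
by rewrite Ef Eg aa bb ab mul0r addr0 !mulr1.
Qed.
Definition mix e (f g : slmx 2 R) : slmx 2 R :=
  exist (fun M : 'M_2 => \det M == 1) _ (mix_subproof e f g).

Lemma mixM e (f g f' g' : slmx 2 R) :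
  mix e (f * f')%g (g * g')%g = (mix e f g * mix e f' g')%g.
Proof.
apply: val_inj => /=.
rewrite mulmxDl !mulmxDr -!scalemxAl -!scalemxAr !scalerA !pt_sqr pt01 pt10.
by rewrite !scale0r addr0 add0r.
Qed.
Lemma mix1 (f g : slmx 2 R) : mix 1%g f g = f.
Proof. by apply: val_inj; rewrite /= !pt_one scale1r scale0r addr0. Qed.
Lemma mix_mul e e' (f g : slmx 2 R) :
  mix (e * e')%g f g = mix e (mix e' f g) (mix e' g f).
Proof.
apply: val_inj; rewrite /= pt_mul0 pt_mul1.
by rewrite !scalerDr !scalerDl !scalerA [X in _ = _ + X]addrC addrACA.
Qed.
End Points.

Definition swap_act (R : comAlg F) (e : C2 R) (x : SL2xSL2 R) : SL2xSL2 R :=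
  (mix e x.1 x.2, mix e x.2 x.1).

Fact swap_mor (R : comAlg F) (e : C2 R) (x y : SL2xSL2 R) :
  swap_act e (x * y)%g = (swap_act e x * swap_act e y)%g.
Proof. by congr pair; apply: mixM. Qed.
Fact swap_1 (R : comAlg F) (x : SL2xSL2 R) : swap_act 1%g x = x.
Proof. by case: x => f g; rewrite /swap_act !mix1. Qed.
Fact swap_M (R : comAlg F) (e e' : C2 R) (x : SL2xSL2 R) :
  swap_act (e * e')%g x = swap_act e (swap_act e' x).
Proof. by rewrite /swap_act !mix_mul. Qed.
Fact swap_nat (R S : comAlg F) (h : algHom R S) (e : C2 R) (x : SL2xSL2 R) :
  swap_act (gmap h e) (gmap h x) = gmap h (swap_act e x).
Proof.
by congr pair; apply: val_inj; apply/matrixP => i j;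
  rewrite !(mxE, ffunE) rmorphD !rmorphM.
Qed.

Definition swap : grpAction C2 SL2xSL2 :=
  GrpAction swap_mor swap_1 swap_M swap_nat.

Definition SL2xSL2_C2 : grpFunctor F := sdprodG swap.
End Swap.

Section Kac.
Variables (F : fieldType) (B : 'M[F]_2).

(* The vector space W has basis w_0, w_1 and form (w_i | w_j) = B i j. The basis
   of K3 is None, for a, and Some i, for w_i. *)
Definition K3b : finType := option 'I_2.
Definition K3_par (x : K3b) : bool := isSome x.

Definition K3_mul (x y : K3b) : fmod F K3b :=
  match x, y with
  | None, None => ebas F (None : K3b)
  | None, Some i | Some i, None => 2^-1 *: ebas F (Some i : K3b)
  | Some i, Some j => B i j *: ebas F (None : K3b)
  end.

Definition K3_form (x y : K3b) : F :=
  match x, y with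
  | None, None => 2^-1
  | Some i, Some j => B i j
  | _, _ => 0
  end.

Fact K3_graded x y z :
  coef (K3_mul x y) z != 0 -> K3_par z = K3_par x (+) K3_par y.
Proof.
case: x y z => [i|] [j|] [k|] //=; rewrite ?coefZ coef_ebas /=;
  by rewrite ?mulr0 eqxx.
Qed.

Definition K3 : superalg F := @Superalg F K3b K3_par K3_mul K3_graded.

(* The basis of K10 is None, for 1, and Some (x, y), for x (x) y. *)
Definition K10b : finType := option (K3b * K3b).
Definition K10_par (b : K10b) : bool :=
  if b is Some (x, y) then K3_par x (+) K3_par y else false.

(* The element u (x) v of K10, for u and v in K3. *)
Definition kron (R : comPzRingType) (u v : fmod R K3b) : fmod R K10b :=
  vec (fun b : K10b => if b is Some (x, y) then coef u x * coef v y else 0).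

Definition K10_mul (b c : K10b) : fmod F K10b :=
  match b, c with
  | None, _ => ebas F c
  | _, None => ebas F b
  | Some (x, y), Some (z, t) =>
      (-1) ^+ (K3_par y && K3_par z) *:
        (kron (K3_mul x z) (K3_mul y t)
         - (3 / 4 * (K3_form x z * K3_form y t)) *: ebas F (None : K10b))
  end.

Lemma K3_form_par x y : K3_form x y != 0 -> K3_par x = K3_par y.
Proof. by case: x y => [i|] [j|] //=; rewrite eqxx. Qed.

Fact K10_graded x y z :
  coef (K10_mul x y) z != 0 -> K10_par z = K10_par x (+) K10_par y.
Proof.
case: x y => [[x1 x2]|] [[y1 y2]|] /=;
  try by rewrite coef_ebas; case: (z =P _) => [->|_] /=;
    rewrite ?eqxx ?addbF.
rewrite coefZ coefB coefZ coef_vec coef_ebas.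
case: z => [[z1 z2]|] /=; rewrite ?mulr0 ?subr0 ?sub0r.
  rewrite !mulf_eq0 !negb_or => /and3P[_ /K3_graded-> /K3_graded->].
  by rewrite addbACA.
rewrite mulr1 mulf_eq0 oppr_eq0 !(mulf_eq0, negb_or).
by case/and3P=> _ _ /andP[/K3_form_par-> /K3_form_par->]; rewrite addbACA !addbb.
Qed.

Definition K10 : superalg F := @Superalg F K10b K10_par K10_mul K10_graded.

Section Scalars.
Variable R : comAlg F.

Definition K3_formR (u v : fmod R K3b) : R :=
  \sum_x \sum_y coef u x * coef v y * alg_in R (K3_form x y).

Lemma kronE (u v : fmod R K3b) :
  kron u v = \sum_p (coef u p.1 * coef v p.2) *: ebas R (Some p : K10b).
Proof.
apply/fmodP => b; rewrite coef_vec coef_sum.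
under eq_bigr do rewrite coefZ coef_ebas.
case: b => [[x y]|]; last by rewrite big1 // => p _; rewrite mulr0.
rewrite (bigD1 (x, y)) //= eqxx mulr1 big1 ?addr0 // => p pxy.
by rewrite (inj_eq Some_inj) eq_sym (negPf pxy) mulr0.
Qed.

Lemma kron_lext (m : K10b -> fmod R K10b) (u v : fmod R K3b) :
  lext m (kron u v) = \sum_p (coef u p.1 * coef v p.2) *: m (Some p).
Proof.
rewrite kronE (@lext_sum F R).
by apply: eq_bigr => p _; rewrite lext_ebas.
Qed.

Lemma bchangeZ (C : finType) a (u : fmod F C) :
  bchange (alg_in R) (a *: u) = alg_in R a *: bchange (alg_in R) u.
Proof. by apply/fmodP => c; rewrite coef_vec !coefZ coef_vec rmorphM. Qed.
Lemma bchangeB (C : finType) (u v : fmod F C) :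
  bchange (alg_in R) (u - v) = bchange (alg_in R) u - bchange (alg_in R) v.
Proof. by apply/fmodP => c; rewrite coef_vec !coefB !coef_vec rmorphB. Qed.
Lemma bchange_ebas (C : finType) (c : C) :
  bchange (alg_in R) (ebas F c) = ebas R c.
Proof. by apply/fmodP => d; rewrite !coef_vec rmorph_nat. Qed.
Lemma bchange_kron (u v : fmod F K3b) :
  bchange (alg_in R) (kron u v) =
    kron (bchange (alg_in R) u) (bchange (alg_in R) v).
Proof.
by apply/fmodP => -[[x y]|]; rewrite !coef_vec ?rmorph0 ?rmorphM.
Qed.

Lemma smul_kron (u v u' v' : fmod R K3b) p q :
  homogeneous (A := K3) p v -> homogeneous (A := K3) q u' ->
  smul (A := K10) (kron u v) (kron u' v') =
    (-1) ^+ (p && q) *: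
      (kron (smul (A := K3) u u') (smul (A := K3) v v')
       - (alg_in R (3 / 4) * (K3_formR u u' * K3_formR v v')) *:
           ebas R (None : K10b)).
Proof.
move=> vH uH; rewrite {1}kronE smul_suml.
under eq_bigr do rewrite kronE smul_sumr scaler_sumr.
pose T (x z y t : K3b) : fmod R K10b :=
  kron (bchange (alg_in R) (K3_mul x z)) (bchange (alg_in R) (K3_mul y t))
  - (alg_in R (3 / 4) * (alg_in R (K3_form x z) * alg_in R (K3_form y t))) *:
      ebas R (None : K10b).
transitivity (\sum_(i : K3b * K3b) \sum_(j : K3b * K3b)
   (-1) ^+ (p && q) *:
     ((coef u i.1 * coef v i.2 * (coef u' j.1 * coef v' j.2)) *:
        T i.1 j.1 i.2 j.2)).
  apply: eq_bigr => -[x y] _; apply: eq_bigr => -[z t] _ /=.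
  rewrite (smul_ebas (A := K10)) scalerA /=.
  have [yp|yp] := eqVneq (K3_par y) p; last by rewrite vH ?mulr0 ?mul0r ?scale0r ?scaler0.
  have [zq|zq] := eqVneq (K3_par z) q; last first.
    by rewrite uH ?mul0r ?mulr0 ?scale0r ?scaler0.
  rewrite yp zq bchangeZ rmorphXn rmorphN rmorph1 [LHS]scalerA [RHS]scalerA.
  rewrite [X in _ = X *: _]mulrC; congr (_ *: _).
  rewrite bchangeB bchange_kron bchangeZ bchange_ebas /T.
  by rewrite !(rmorphM (alg_in R) (3 / 4)) (rmorphM (alg_in R) (K3_form x z)).
under eq_bigr do rewrite -scaler_sumr.
rewrite -scaler_sumr; congr (_ *: _).
rewrite -(pair_big xpredT xpredT (fun x y => \sum_j
  (coef u x * coef v y * (coef u' j.1 * coef v' j.2)) *: T x j.1 y j.2)) /=.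
under eq_bigr do under eq_bigr do rewrite
  -(pair_big xpredT xpredT (fun z t => (coef u _ * coef v _ * (coef u' z * coef v' t)) *: T _ z _ t)) /=.
under eq_bigr do rewrite exchange_big /=.
apply/fmodP => c; rewrite coef_sum coefB coefZ coef_ebas coef_vec.
under eq_bigr do rewrite coef_sum.
under eq_bigr do under eq_bigr do rewrite coef_sum.
under eq_bigr do under eq_bigr do under eq_bigr do rewrite coef_sum.
case: c => [[c1 c2]|] /=.
  rewrite mulr0 subr0 /smul !coef_sum mulr_suml; apply: eq_bigr => x _.
  rewrite !coef_sum mulr_suml; apply: eq_bigr => z _.
  rewrite mulr_sumr; apply: eq_bigr => y _.
  rewrite coef_sum mulr_sumr; apply: eq_bigr => t _.
  rewrite /T !coefZ coefB coefZ coef_ebas !coef_vec /= ?coef_vec; ring.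
rewrite sub0r mulr1 /K3_formR mulr_suml mulr_sumr -sumrN; apply: eq_bigr => x _.
rewrite mulr_suml mulr_sumr -sumrN; apply: eq_bigr => z _.
rewrite !mulr_sumr -sumrN; apply: eq_bigr => y _.
rewrite !mulr_sumr -sumrN; apply: eq_bigr => t _.
rewrite /T !coefZ coefB coefZ coef_ebas !coef_vec /=; ring.
Qed.
(* The even linear map of K3 fixing a and acting on W, viewed as a space of
   column vectors, by the matrix f. *)
Definition K3_ext (f : 'M[R]_2) (x : K3b) : fmod R K3b :=
  if x is Some j then vec (fun y : K3b => if y is Some i then f i j else 0)
  else ebas R (None : K3b).

Definition phi_basis (f g : 'M[R]_2) (b : K10b) : fmod R K10b :=
  if b is Some (x, y) then kron (K3_ext f x) (K3_ext g y)
  else ebas R (None : K10b).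

Definition tau_basis (b : K10b) : fmod R K10b :=
  if b is Some (x, y)
  then (-1) ^+ (K3_par x && K3_par y) *: ebas R (Some (y, x) : K10b)
  else ebas R (None : K10b).

(* The action of the point e of the constant group scheme C_2: the identity
   where e 0 = 1 and tau where e 1 = 1. *)
Definition tau_pt (e : cpoint 'Z_2 R) (b : K10b) : fmod R K10b :=
  val e 0 *: ebas R b + val e 1 *: tau_basis b.

Lemma big_K3 (V : nmodType) (G : K3b -> V) :
  \sum_x G x = G None + (G (Some 0) + G (Some 1)).
Proof.
rewrite (bigD1 None) //= (bigD1 (Some 0)) //= (bigD1 (Some 1)) //=.
by rewrite big1 ?addr0 // => -[[[|[|]] // i]|] //=.
Qed.

Lemma K3_ext_hom f x : homogeneous (A := K3) (K3_par x) (K3_ext f x).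
Proof. by case: x => [i|] [j|] //= _; rewrite coef_vec. Qed.

Lemma K3_mul_hom x y :
  homogeneous (A := K3) (K3_par x (+) K3_par y)
    (bchange (alg_in R) (K3_mul x y)).
Proof.
move=> z zxy; rewrite coef_vec.
have [->|/K3_graded E] := eqVneq (coef (K3_mul x y) z) 0; first exact: rmorph0.
by case/negP: zxy; rewrite /= E.
Qed.

Lemma lext_id (C : finType) (v : fmod R C) : lext (fun c => ebas R c) v = v.
Proof. by have /(_ v) := @linear_lext R C C idfun (fun _ _ _ => erefl). Qed.
End Scalars.

Lemma K3_ext_map (R S : comAlg F) (f : algHom R S) (m : 'M[R]_2) x :
  bchange f (K3_ext m x) = K3_ext (map_mx f m) x.
Proof.
apply/fmodP => y; rewrite !coef_vec; case: x => [i|] /=; last first.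
  by rewrite !coef_ebas rmorph_nat.
by rewrite !coef_vec; case: y => [j|]; rewrite ?rmorph0 ?mxE.
Qed.

Section Phi.
Hypothesis char2 : 2%N \notin [pchar F].
Hypothesis skewB : B^T = - B.

Lemma two_neq0 : (2 : F) != 0.
Proof. by move: char2; rewrite inE. Qed.

Lemma B_diag i : B i i = 0.
Proof.
have /matrixP/(_ i i) := skewB; rewrite !mxE => E.
have : 2 * B i i = 0 by rewrite mulr_natl mulr2n {1}E addNr.
by move/eqP; rewrite mulf_eq0 (negPf two_neq0) => /eqP.
Qed.
Lemma B10 : B 1 0 = - B 0 1.
Proof. by have /matrixP/(_ 0 1) := skewB; rewrite !mxE. Qed.

Lemma ord2P (i : 'I_2) : i = 0 \/ i = 1.
Proof. by case: i => [[|[|]]] //= i; [left|right]; apply: val_inj. Qed.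

Section Automorphisms.
Variable R : comAlg F.
Implicit Types f g : slmx 2 R.

Lemma half2 : alg_in R 2^-1 * 2 = 1.
Proof.
by rewrite -(rmorph_nat (alg_in R)) -rmorphM mulVf ?rmorph1 // two_neq0.
Qed.

Lemma K3_ext_form f x y :
  K3_formR (K3_ext (val f) x) (K3_ext (val f) y) = alg_in R (K3_form x y).
Proof.
rewrite /K3_formR !big_K3.
move: (sl_det f); move: (val f) => m E.
case: x y => [i|] [j|] //=; rewrite !coef_vec /= !B_diag B10 rmorphN rmorph0.
- have {E} : (m 0 i * m 1 j - m 1 i * m 0 j) * alg_in R (B 0 1)
     = alg_in R (B i j).
    case: (ord2P i) => ->; case: (ord2P j) => ->; rewrite ?B_diag ?B10.
    + by rewrite rmorph0 mulrC (mulrC (m 1 0)) subrr mulr0.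
    + by rewrite (mulrC (m 1 0)) E mul1r.
    + rewrite -[RHS]mulr1 rmorphN -E; ring.
    + by rewrite rmorph0 mulrC (mulrC (m 1 1)) subrr mulr0.
  by move=> <-; ring.
- ring.
- ring.
- ring.
Qed.

Lemma K3_ext_mul f x y :
  smul (A := K3) (K3_ext (val f) x) (K3_ext (val f) y) =
  lext (K3_ext (val f)) (bchange (alg_in R) (K3_mul x y)).
Proof.
have E := K3_ext_form f x y; rewrite /K3_formR !big_K3 in E.
apply/fmodP => z; rewrite /smul !big_K3 !coefD !coefZ coef_lext !big_K3.
rewrite !coef_vec /= ?coefZ ?coef_ebas.
move: E.
case: x y => [i|] [j|]; case: z => [k|] //=; rewrite !coef_vec /= ?coefZ ?coef_ebas.
all: try (case: (ord2P k) => ->).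
all: rewrite -?/(coef _ _) ?coefZ ?coef_ebas.
all: rewrite /= ?mulr0 ?mulr1 ?mul0r ?mul1r ?rmorph0 ?rmorph1.
all: rewrite /GRing.scale /= ?(mulr0, mulr1, mul0r, mul1r, rmorph0).
all: rewrite ?(mulr0, mul0r, addr0, add0r) //.
1-2: case: (ord2P i) => -> _.
5-6: case: (ord2P j) => -> _.
all: rewrite /= ?(mulr0, mulr1, mul0r, mul1r, rmorph0).
all: rewrite ?(mulr0, mul0r, addr0, add0r) //.
all: exact: mulrC.
Qed.

Lemma lextZ (C D : finType) (m : C -> fmod R D) a v :
  lext m (a *: v) = a *: lext m v.
Proof.
by have := lext_linear m a v 0; rewrite addr0 (linear_zero (lext_linear m)) addr0.
Qed.
Lemma lextD (C D : finType) (m : C -> fmod R D) u v :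
  lext m (u + v) = lext m u + lext m v.
Proof. by have := lext_linear m 1 u v; rewrite !scale1r. Qed.
Lemma lextB (C D : finType) (m : C -> fmod R D) u v :
  lext m (u - v) = lext m u - lext m v.
Proof. by rewrite -scaleN1r lextD lextZ scaleN1r. Qed.

Lemma K10_one_l (v : fmod R K10b) : smul (A := K10) (ebas R (None : K10b)) v = v.
Proof.
rewrite -{1}(lext_id v) /lext smul_sumr -[RHS]lext_id; apply: eq_bigr => b _.
by rewrite (smul_ebas (A := K10)) bchange_ebas.
Qed.
Lemma K10_one_r (v : fmod R K10b) : smul (A := K10) v (ebas R (None : K10b)) = v.
Proof.
rewrite -{1}(lext_id v) /lext smul_suml -[RHS]lext_id; apply: eq_bigr => b _.
by rewrite (smul_ebas (A := K10)); case: b => [[x y]|]; rewrite bchange_ebas.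
Qed.

Lemma lext_phi_kron f g u v :
  lext (phi_basis (val f) (val g)) (kron u v) =
    kron (lext (K3_ext (val f)) u) (lext (K3_ext (val g)) v).
Proof.
rewrite kron_lext; apply/fmodP => c; rewrite coef_sum coef_vec.
have E p d : coef (phi_basis (val f) (val g) (Some p)) d =
    if d is Some (x, y) then coef (K3_ext (val f) p.1) x *
      coef (K3_ext (val g) p.2) y else 0.
  by case: p => x y; rewrite coef_vec.
under eq_bigr do rewrite coefZ E.
case: c => [[c1 c2]|]; last by rewrite big1 // => p _; rewrite mulr0.
rewrite !coef_lext mulr_suml.
under [RHS]eq_bigr do rewrite mulr_sumr.
rewrite pair_big /=; apply: eq_bigr => -[x y] _ /=; exact: mulrACA.
Qed.

Lemma phi_mul f g x y :
  lext (phi_basis (val f) (val g)) (bchange (alg_in R) (K10_mul x y)) =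
  smul (A := K10) (phi_basis (val f) (val g) x : fmod R K10b)
    (phi_basis (val f) (val g) y).
Proof.
case: x y => [[x y]|] [[z t]|] /=;
  rewrite ?K10_one_l ?K10_one_r ?bchange_ebas ?lext_ebas //.
rewrite (smul_kron _ _ (@K3_ext_hom R (val g) y) (@K3_ext_hom R (val f) z)).
rewrite bchangeZ bchangeB bchange_kron bchangeZ bchange_ebas lextZ lextB lextZ.
rewrite lext_phi_kron lext_ebas !K3_ext_mul !K3_ext_form /=.
by rewrite rmorphXn rmorphN rmorph1 (rmorphM _ (3 / 4)) (rmorphM _ (K3_form x z)).
Qed.

Lemma phi_hom f g x :
  homogeneous (A := K10) (K10_par x) (phi_basis (val f) (val g) x).
Proof.
case: x => [[x y]|] b /= bx; last first.
  by rewrite coef_ebas; case: (b =P None) bx => [->|].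
rewrite coef_vec; case: b bx => [[z t]|] //=.
have [->|zx] := eqVneq (K3_par z) (K3_par x); last first.
  by rewrite (@K3_ext_hom R (val f) x z zx) mul0r.
by rewrite (inj_eq (@addbI _)) => /(@K3_ext_hom R (val g) y t) ->; rewrite mulr0.
Qed.

Lemma K3_ext_comp f g x :
  lext (K3_ext (val f)) (K3_ext (val g) x) = K3_ext (val (f * g)%g) x.
Proof.
case: x => [i|] /=; last by rewrite lext_ebas.
apply/fmodP => c; rewrite coef_lext big_K3 !coef_vec mul0r add0r.
case: c => [j|]; rewrite ?coef_vec ?mulr0 ?addr0 //.
by rewrite mxE !big_ord_recl big_ord0 addr0 mulrC;
  congr (_ + _); rewrite mulrC; congr (val f _ _ * val g _ _); apply: val_inj.
Qed.
Lemma K3_ext1 x : K3_ext (val (1%g : slmx 2 R)) x = ebas R x.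
Proof.
case: x => [i|] //=; apply/fmodP => -[j|]; rewrite coef_vec coef_ebas //.
by rewrite mxE (inj_eq Some_inj).
Qed.

Lemma phi_comp f g f' g' :
  lext (phi_basis (val f) (val g)) \o lext (phi_basis (val f') (val g')) =1
  lext (phi_basis (val (f * f')%g) (val (g * g')%g)).
Proof.
move=> v /=; rewrite [in LHS]/lext -/(lext _ _).
rewrite {2}/lext (@lext_sum F R); apply: eq_bigr => -[[x y]|] _ /=.
  by rewrite lext_phi_kron !K3_ext_comp.
by rewrite lext_ebas.
Qed.
Lemma kron_ebas x y :
  kron (ebas R (x : K3b)) (ebas R (y : K3b)) = ebas R (Some (x, y) : K10b).
Proof.
apply/fmodP => -[[z t]|]; rewrite coef_vec !coef_ebas //.
by rewrite (inj_eq Some_inj) xpair_eqE -natrM mulnb.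
Qed.
Lemma phi1 : lext (phi_basis (val (1%g : slmx 2 R)) (val (1%g : slmx 2 R))) =1 id.
Proof.
move=> v; rewrite -[RHS]lext_id; apply: eq_bigr => -[[x y]|] _ //=.
by rewrite !K3_ext1 kron_ebas.
Qed.

Fact phi_saut_subproof (x : pgrp (SLn F 2) (SLn F 2) R) :
  is_saut (A := K10) (lext (phi_basis (val x.1) (val x.2))).
Proof.
case: x => f g /=; split; first exact: lext_linear.
- exists (lext (phi_basis (val f^-1%g) (val g^-1%g))) => v.
    by rewrite -[LHS]/((_ \o _) v) phi_comp !mulVg phi1.
  by rewrite -[LHS]/((_ \o _) v) phi_comp !mulgV phi1.
- exact/(lext_morph (A := K10))/phi_mul.
- exact/(lext_homogeneous (A := K10))/phi_hom.
Qed.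
Definition phi_saut (x : pgrp (SLn F 2) (SLn F 2) R) : saut K10 R :=
  mk_saut (phi_saut_subproof x).

Lemma tau_tau x : lext (@tau_basis R) (tau_basis R x) = ebas R x.
Proof.
case: x => [[x y]|] /=; rewrite ?lextZ lext_ebas //= scalerA andbC.
by rewrite -signr_addb addbb scale1r.
Qed.

Lemma tau_kron u v p q :
  homogeneous (A := K3) p u -> homogeneous (A := K3) q v ->
  lext (@tau_basis R) (kron u v) = (-1) ^+ (p && q) *: kron v u.
Proof.
move=> uH vH; rewrite kron_lext kronE scaler_sumr.
have swap_inj : injective (fun r : K3b * K3b => (r.2, r.1)).
  by move=> [x y] [z t] [-> ->].
rewrite [RHS](reindex_inj swap_inj); apply: eq_bigr => -[x y] _ /=.
have [xp|xp] := eqVneq (K3_par x) p; last by rewrite uH // !(mul0r, mulr0, scale0r, scaler0).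
have [yq|yq] := eqVneq (K3_par y) q; last by rewrite vH // !(mul0r, mulr0, scale0r, scaler0).
by rewrite xp yq !scalerA mulrC (mulrC (coef u x)).
Qed.

Lemma smulZl (u v : fmod R K10b) a :
  smul (A := K10) (a *: u) v = a *: smul (A := K10) u v.
Proof.
by have := smul_suml (A := K10) [:: tt] (fun=> a) (fun=> u) v; rewrite !big_seq1.
Qed.
Lemma smulZr (u v : fmod R K10b) a :
  smul (A := K10) u (a *: v) = a *: smul (A := K10) u v.
Proof.
by have := smul_sumr (A := K10) [:: tt] (fun=> a) (fun=> v) u; rewrite !big_seq1.
Qed.
Lemma smulDl (u u' v : fmod R K10b) :
  smul (A := K10) (u + u') v = smul (A := K10) u v + smul (A := K10) u' v.
Proof.
have := smul_suml (A := K10) [:: true; false] (fun=> 1)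
  (fun b => if b then u else u') v.
by rewrite !big_cons !big_nil /= !addr0 !scale1r.
Qed.
Lemma smulDr (u v v' : fmod R K10b) :
  smul (A := K10) u (v + v') = smul (A := K10) u v + smul (A := K10) u v'.
Proof.
have := smul_sumr (A := K10) [:: true; false] (fun=> 1)
  (fun b => if b then v else v') u.
by rewrite !big_cons !big_nil /= !addr0 !scale1r.
Qed.

Lemma tau_mul x y :
  lext (@tau_basis R) (bchange (alg_in R) (K10_mul x y)) =
  smul (A := K10) (tau_basis R x : fmod R K10b) (tau_basis R y).
Proof.
case: x y => [[x y]|] [[z t]|];
  rewrite /= ?K10_one_l ?K10_one_r ?bchange_ebas ?lext_ebas //.
rewrite smulZl smulZr (smul_ebas (A := K10)) /=.
rewrite !bchangeZ !bchangeB !bchange_kron !bchangeZ bchange_ebas.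
rewrite lextZ lextB lextZ lext_ebas /=.
rewrite (tau_kron (@K3_mul_hom R x z) (@K3_mul_hom R y t)) !scalerBr !scalerA.
rewrite !rmorphXn !rmorphN !rmorph1 -!signr_addb.
congr (_ *: _ - _); first congr (_ ^+ _).
  by case: (K3_par x) (K3_par y) (K3_par z) (K3_par t) => [] [] [] [].
congr (_ *: _).
have [->|/K3_form_par xz] := eqVneq (K3_form x z) 0.
  by rewrite !(mul0r, mulr0) rmorph0 !mulr0.
have [->|/K3_form_par yt] := eqVneq (K3_form y t) 0.
  by rewrite !(mul0r, mulr0) rmorph0 !mulr0.
rewrite xz yt [K3_form y t * _]mulrC; congr (_ ^+ _ * _).
by case: (K3_par z) (K3_par t) => [] [].
Qed.

Lemma tau_hom x : homogeneous (A := K10) (K10_par x) (tau_basis R x).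
Proof.
case: x => [[x y]|] b /= bx; rewrite ?coefZ coef_ebas;
  case: (b =P _) bx => [->|_] /=; rewrite ?mulr0 ?eqxx //.
by rewrite addbC eqxx.
Qed.

Lemma lext_tau_pt (e : cpoint 'Z_2 R) v :
  lext (tau_pt e) v = val e 0 *: v + val e 1 *: lext (@tau_basis R) v.
Proof.
rewrite -{2}(lext_id v) /lext !scaler_sumr -big_split; apply: eq_bigr => b _ /=.
by rewrite scalerDr !scalerA !(mulrC (coef v b)).
Qed.

Lemma tau_pt_mul (e : cpoint 'Z_2 R) x y :
  lext (tau_pt e) (bchange (alg_in R) (K10_mul x y)) =
  smul (A := K10) (tau_pt e x : fmod R K10b) (tau_pt e y).
Proof.
rewrite lext_tau_pt tau_mul /tau_pt smulDl !smulDr !smulZl !smulZr !scalerA.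
by rewrite !pt_sqr pt01 pt10 !scale0r addr0 add0r (smul_ebas (A := K10)).
Qed.

Lemma tau_pt_hom (e : cpoint 'Z_2 R) x : homogeneous (A := K10) (K10_par x) (tau_pt e x).
Proof.
move=> b bx; rewrite coefD !coefZ (@tau_hom x b bx) coef_ebas.
by case: (b =P x) bx => [->|]; rewrite ?eqxx // !mulr0 addr0.
Qed.

Lemma tauK v : lext (@tau_basis R) (lext (@tau_basis R) v) = v.
Proof.
rewrite {2}/lext (@lext_sum F R) -[RHS]lext_id.
by apply: eq_bigr => b _; rewrite tau_tau.
Qed.

Lemma tau_pt_comp (e e' : cpoint 'Z_2 R) :
  lext (tau_pt e) \o lext (tau_pt e') =1 lext (tau_pt (e * e')%g).
Proof.
move=> v; rewrite /= !lext_tau_pt lextD !lextZ tauK pt_mul0 pt_mul1.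
by rewrite !scalerDr !scalerDl !scalerA [X in _ + X = _]addrC addrACA.
Qed.
Lemma tau_pt1 : lext (tau_pt (1%g : cpoint 'Z_2 R)) =1 id.
Proof. by move=> v; rewrite lext_tau_pt !pt_one scale1r scale0r addr0. Qed.

Fact tau_saut_subproof (e : cpoint 'Z_2 R) : is_saut (A := K10) (lext (tau_pt e)).
Proof.
split; first exact: lext_linear.
- exists (lext (tau_pt e^-1%g)) => v.
    by rewrite -[LHS]/((_ \o _) v) tau_pt_comp mulVg tau_pt1.
  by rewrite -[LHS]/((_ \o _) v) tau_pt_comp mulgV tau_pt1.
- exact/(lext_morph (A := K10))/tau_pt_mul.
- exact/(lext_homogeneous (A := K10))/tau_pt_hom.
Qed.
Definition tau_saut (e : cpoint 'Z_2 R) : saut K10 R :=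
  mk_saut (tau_saut_subproof e).

Lemma tau_saut_mul e e' : tau_saut (e * e')%g = (tau_saut e * tau_saut e')%g.
Proof. by apply: val_inj; apply/esym/funext/tau_pt_comp. Qed.
Lemma phi_saut_mul x y : phi_saut (x * y)%g = (phi_saut x * phi_saut y)%g.
Proof.
by case: x y => f g [f' g']; apply: val_inj; apply/esym/funext/phi_comp.
Qed.

Lemma coef_phi f g x y z t :
  coef (phi_basis (val f) (val g) (Some (x, y))) (Some (z, t)) =
    coef (K3_ext (val f) x) z * coef (K3_ext (val g) y) t.
Proof. by rewrite coef_vec. Qed.

Lemma K3_ext_mix (e : cpoint 'Z_2 R) f g x :
  K3_ext (val (mix e f g)) x =
    val e 0 *: K3_ext (val f) x + val e 1 *: K3_ext (val g) x.
Proof.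
apply/fmodP => y; rewrite coefD !coefZ; case: x => [i|] /=.
  by rewrite !coef_vec; case: y => [j|]; rewrite ?mxE // !mulr0 addr0.
by rewrite -mulrDl pt_sum mul1r.
Qed.

Lemma tau_phi f g x :
  lext (@tau_basis R) (phi_basis (val f) (val g) x) =
  lext (phi_basis (val g) (val f)) (tau_basis R x).
Proof.
case: x => [[x y]|] /=; last by rewrite !lext_ebas.
rewrite (tau_kron (@K3_ext_hom R (val f) x) (@K3_ext_hom R (val g) y)).
by rewrite lextZ lext_ebas.
Qed.

Lemma phi_mix (e : cpoint 'Z_2 R) f g x :
  phi_basis (val (mix e f g)) (val (mix e g f)) x =
    val e 0 *: phi_basis (val f) (val g) x
    + val e 1 *: phi_basis (val g) (val f) x.
Proof.
case: x => [[x y]|] /=; last by rewrite -scalerDl pt_sum scale1r.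
rewrite !K3_ext_mix; apply/fmodP => b; rewrite coefD !coefZ !coef_vec.
case: b => [[z t]|]; rewrite ?mulr0 ?addr0 // !coefD !coefZ.
move: (pt_sqr e 0) (pt_sqr e 1) (pt01 e) => aa bb ab.
set p := coef (K3_ext (val f) x) z; set q := coef (K3_ext (val g) x) z.
set r := coef (K3_ext (val g) y) t; set w := coef (K3_ext (val f) y) t.
transitivity (val e 0 * val e 0 * (p * r) + val e 1 * val e 1 * (q * w)
  + val e 0 * val e 1 * (p * w + q * r)); first by ring.
by rewrite aa bb ab mul0r addr0.
Qed.

Lemma tau_phi_swap (e : cpoint 'Z_2 R) (x : SL2xSL2 F R) :
  (tau_saut e * phi_saut x)%g = (phi_saut (swap_act e x) * tau_saut e)%g.
Proof.
case: x => f g; apply: saut_ext => b /=; rewrite !lext_ebas.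
set P := phi_basis (val f) (val g); set Q := phi_basis (val g) (val f).
have mixE v : lext (phi_basis (val (mix e f g)) (val (mix e g f))) v =
    val e 0 *: lext P v + val e 1 *: lext Q v.
  rewrite /lext !scaler_sumr -big_split; apply: eq_bigr => c _ /=.
  by rewrite phi_mix scalerDr !scalerA !(mulrC (coef v c)).
rewrite -[RHS]/(lext (phi_basis (val (mix e f g)) (val (mix e g f))) _) mixE.
rewrite lext_tau_pt tau_phi /tau_pt !lextD !lextZ !lext_ebas !scalerDr !scalerA.
by rewrite !pt_sqr pt01 pt10 !scale0r addr0 add0r.
Qed.

Definition Phi_fun (x : SL2xSL2_C2 F R) : AutG K10 R :=
  (phi_saut x.1 * tau_saut x.2)%g.

Fact Phi_funM (x y : SL2xSL2_C2 F R) :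
  Phi_fun (x * y)%g = (Phi_fun x * Phi_fun y)%g.
Proof.
rewrite /Phi_fun /= phi_saut_mul tau_saut_mul.
by rewrite -!mulgA; congr (_ * _)%g; rewrite !mulgA tau_phi_swap.
Qed.
End Automorphisms.

Lemma bchangeD (R S : comAlg F) (h : algHom R S) (C : finType)
    (u v : fmod R C) :
  bchange h (u + v) = bchange h u + bchange h v.
Proof. by apply/fmodP => c; rewrite coef_vec !coefD !coef_vec rmorphD. Qed.
Lemma bchange_scale (R S : comAlg F) (h : algHom R S) (C : finType) a
    (u : fmod R C) :
  bchange h (a *: u) = h a *: bchange h u.
Proof. by apply/fmodP => c; rewrite coef_vec !coefZ coef_vec rmorphM. Qed.
Lemma bchange_basis (R S : comAlg F) (h : algHom R S) (C : finType) (c : C) :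
  bchange h (ebas R c) = ebas S c.
Proof. by apply/fmodP => d; rewrite !coef_vec rmorph_nat. Qed.

Fact Phi_nat (R S : comAlg F) (h : algHom R S) (x : SL2xSL2_C2 F R) :
  Phi_fun (gmap h x) = gmap h (Phi_fun x).
Proof.
case: x => [[f g] e]; rewrite /Phi_fun gmapM; congr (_ * _)%g.
  apply: saut_ext => b /=; rewrite /lchange !lext_ebas.
  case: b => [[x y]|] /=; last by rewrite bchange_basis.
  rewrite -!K3_ext_map; apply/fmodP => -[[z t]|]; rewrite !coef_vec.
    by rewrite rmorphM.
  by rewrite rmorph0.
apply: saut_ext => b /=; rewrite /lchange !lext_ebas /tau_pt.
rewrite bchangeD !bchange_scale bchange_basis !ffunE.
congr (_ + _ *: _); case: b => [[x y]|] /=; last by rewrite bchange_basis.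
by rewrite bchange_scale bchange_basis rmorphXn rmorphN1.
Qed.

Definition Phi : grpHom (SL2xSL2_C2 F) (AutG K10) :=
  @GrpHom F (SL2xSL2_C2 F) (AutG K10) Phi_fun Phi_funM Phi_nat.
End Phi.
End Kac.

(* Main.v *)
Require Import Defs.
From HB Require Import structures.
From mathcomp Require Import all_boot all_fingroup all_algebra.
From mathcomp Require Import ring boolp.
From mathcomp Require classical_sets.

Set Implicit Arguments.
Unset Strict Implicit.
Unset Printing Implicit Defensive.

Import GRing.Theory.
Local Open Scope ring_scope.

(* Write eps = a (x) a. An automorphism phi of K10 (x) R fixes eps: phi(eps) acts
   as 1/2 on the odd part, which leaves phi(eps) = c 1 + d eps with
   2 c + d = 1, and (4 eps - 1) y is a multiple of 4 eps - 1 for even y, which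
   forces d = 1. Put phi(w_j (x) a) = f_j (x) a + a (x) h_j and
   phi(a (x) w_j) = k_j (x) a + a (x) g_j. Since
   (w_0 (x) a)(w_1 (x) a) lies in R 1 + R eps it is fixed, whence
   det f + det h = 1 and f_i0 h_j1 = f_i1 h_j0; so det f and det h are orthogonal
   idempotents with (det f) h = 0 = (det h) f, and likewise for g, k. Surjectivity
   of phi matches the two pairs of idempotents, and phi is the image of
   ((f + k, g + h), (det f, det h)). The argument is uniform in the
   characteristic, including 3.

   For the cohomology, contracting the first tensor slot of a GL_n-cocycle M with
   linear functionals theta of L over F gives matrices N with
   M d1(N) = d0(N), and these span; this is Hilbert 90. A cocycle ((f, g), e) of
   (SL_2 x SL_2) : C_2 becomes a GL_4-cocycle through the block matrices
   (e_0 f, e_1 f; e_1 g, e_0 g). From its trivialization one extracts two columns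
   whose upper and lower 2 x 2 blocks (U, V) are both invertible; rescaling one
   column by (det U, det V)^-1 preserves the descent equation and gives a point of
   (SL_2 x SL_2)(L) through which ((f, g), e) is cohomologous to (1, e). *)

(** * Automorphisms of K10 over a commutative algebra *)

Section KacAut.
Variables (F : fieldType) (B : 'M[F]_2).
Hypothesis char2 : 2%N \notin [pchar F].
Hypothesis skewB : B^T = - B.
Hypothesis nzB : B != 0.

Lemma B01_neq0 : B 0 1 != 0.
Proof.
apply: contra_neq nzB => B01; apply/matrixP => i j; rewrite mxE.
by case: (ord2P i) => ->; case: (ord2P j) => ->;
  rewrite ?(B_diag char2 skewB) ?(B10 skewB) ?B01 ?oppr0.
Qed.

(** * Products in K10 (x) R, in coordinates *)

Section ScalarExtension.
Variable R : comAlg F.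
Local Notation A := (K10 B).
Local Notation one := (ebas R (None : K10b)).
Local Notation bas x y := (ebas R (Some (x, y) : K10b)).
Local Notation half := (alg_in R 2^-1).

Lemma big_K10 (V : nmodType) (G : K10b -> V) :
  \sum_b G b = G None + \sum_x \sum_y G (Some (x, y)).
Proof.
rewrite pair_big (bigD1 None) //=; congr (_ + _).
rewrite (reindex_omap (Some : K3b * K3b -> K10b) id) /=; last by case.
by apply: eq_big => -[x y] //=; rewrite eqxx.
Qed.

Lemma coef_smul (u v : fmod R K10b) c :
  coef (smul (A := A) u v) c =
    \sum_x \sum_y coef u x * coef v y * alg_in R (coef (K10_mul B x y) c).
Proof.
rewrite /smul Defs.coef_sum; apply: eq_bigr => x _.
rewrite Defs.coef_sum; apply: eq_bigr => y _.
by rewrite Defs.coefZ coef_vec.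
Qed.

Definition odd_elt u := homogeneous (A := A) (R := R) true u.
Definition even_elt u := homogeneous (A := A) (R := R) false u.

Lemma odd_coef u : odd_elt u -> [/\ coef u None = 0, coef u (Some (None, None)) = 0
  & forall i j, coef u (Some (Some i, Some j)) = 0].
Proof. by move=> uo; split=> [||i j]; apply: uo. Qed.
Lemma even_coef u : even_elt u -> (forall i, coef u (Some (Some i, None)) = 0) /\
  (forall i, coef u (Some (None, Some i)) = 0).
Proof. by move=> uo; split=> i; apply: uo. Qed.

Lemma B00 : B 0 0 = 0. Proof. exact: B_diag. Qed.
Lemma B11 : B 1 1 = 0. Proof. exact: B_diag. Qed.

Lemma K3_mulE x y c : coef (K3_mul B x y) c =
  match x, y, c with
  | None, None, None => 1
  | None, Some i, Some j | Some i, None, Some j => (j == i)%:R / 2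
  | Some i, Some j, None => B i j
  | _, _, _ => 0
  end.
Proof.
by case: x y c => [i|] [j|] [k|] //=; rewrite ?Defs.coefZ coef_ebas /= ?mulr0 ?mulr1 // mulrC.
Qed.

Lemma K3_coef_smul (p q : fmod R K3b) c :
  coef (smul (A := K3 B) p q) c =
  if c is Some i
  then half * (coef p None * coef q (Some i) + coef p (Some i) * coef q None)
  else coef p None * coef q None
   + alg_in R (B 0 1) *
       (coef p (Some 0) * coef q (Some 1) - coef p (Some 1) * coef q (Some 0)).
Proof.
transitivity (\sum_x \sum_y coef p x * coef q y * alg_in R (coef (K3_mul B x y) c)).
  rewrite Defs.coef_sum; apply: eq_bigr => x _; rewrite Defs.coef_sum.
  by apply: eq_bigr => y _; rewrite Defs.coefZ coef_vec.
under eq_bigr do under eq_bigr do rewrite K3_mulE.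
rewrite !big_K3; case: c => [i|].
  by case: (ord2P i) => -> /=; rewrite ?mul1r ?mul0r ?rmorph0; ring.
rewrite !B00 !B11 !(B10 skewB) !rmorphN !rmorph0 rmorph1; ring.
Qed.

(** An odd element has the form l (x) a + a (x) r with l and r in W. Placing l and r in K3 makes the
    product formula for pure tensors available. *)
Definition lpart (u : fmod R K10b) : fmod R K3b :=
  vec (fun b : K3b => if b is Some i then coef u (Some (Some i, None)) else 0).
Definition rpart (u : fmod R K10b) : fmod R K3b :=
  vec (fun b : K3b => if b is Some i then coef u (Some (None, Some i)) else 0).

Lemma odd_kron u : odd_elt u ->
  u = kron (lpart u) (ebas R (None : K3b)) + kron (ebas R (None : K3b)) (rpart u).
Proof.
move=> /odd_coef[u0 uE uW]; apply/fmodP => c; rewrite Defs.coefD !coef_vec.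
by case: c => [[[i|] [j|]]|]; rewrite ?u0 ?uE ?uW ?coef_vec ?coef_ebas /=
  ?(mulr0, mul0r, mulr1, mul1r, addr0, add0r).
Qed.

Lemma lpart_hom u : homogeneous (A := K3 B) true (lpart u).
Proof. by case=> [i|] //= _; rewrite coef_vec. Qed.
Lemma rpart_hom u : homogeneous (A := K3 B) true (rpart u).
Proof. by case=> [i|] //= _; rewrite coef_vec. Qed.
Lemma ebasN_hom : homogeneous (A := K3 B) (R := R) false (ebas R (None : K3b)).
Proof. by case=> [i|] //= _; rewrite coef_vec. Qed.

Lemma coef_smul_kron (u v u' v' : fmod R K3b) p q x y :
  homogeneous (A := K3 B) p v -> homogeneous (A := K3 B) q u' ->
  coef (smul (A := A) (kron u v) (kron u' v')) (Some (x, y)) =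
  (-1) ^+ (p && q) * (coef (smul (A := K3 B) u u') x * coef (smul (A := K3 B) v v') y).
Proof.
move=> vH uH; rewrite (smul_kron _ _ vH uH) Defs.coefZ Defs.coefB Defs.coefZ coef_ebas.
by rewrite coef_vec mulr0 subr0.
Qed.

(** By [odd_kron] and bilinearity this is a sum of four products of pure tensors. Two like summands
    contribute a symplectic form at a (x) a, two unlike ones a vector of W (x) W; the sign comes
    from exchanging two odd factors. *)
Lemma odd_mul u v : odd_elt u -> odd_elt v ->
 (coef (smul (A := A) u v) (Some (None, None)) =
  alg_in R (B 0 1) *
    (coef u (Some (Some 0, None)) * coef v (Some (Some 1, None))
    - coef u (Some (Some 1, None)) * coef v (Some (Some 0, None))
    + (coef u (Some (None, Some 0)) * coef v (Some (None, Some 1))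
    - coef u (Some (None, Some 1)) * coef v (Some (None, Some 0)))))
 * (forall i j, coef (smul (A := A) u v) (Some (Some i, Some j)) =
   half * half * (coef u (Some (Some i, None)) * coef v (Some (None, Some j))
    - coef u (Some (None, Some j)) * coef v (Some (Some i, None)))).
Proof.
move=> /odd_kron uE /odd_kron vE.
have uvE : smul (A := A) u v = _ := congr2 _ uE vE.
rewrite smulDl !smulDr in uvE.
pose a := ebas R (None : K3b).
have E x y := (coef_smul_kron (lpart u) a x y ebasN_hom (@lpart_hom v),
 coef_smul_kron (lpart u) (rpart v) x y ebasN_hom ebasN_hom,
 coef_smul_kron a a x y (@rpart_hom u) (@lpart_hom v),
 coef_smul_kron a (rpart v) x y (@rpart_hom u) ebasN_hom).
split=> [|i j]; rewrite uvE.
  by rewrite 3!Defs.coefD !E /a !K3_coef_smul !coef_vec /=; ring.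
by rewrite 3!Defs.coefD !E /a !K3_coef_smul !coef_vec /=; ring.
Qed.

Lemma K10_mulE x y z t c : coef (K10_mul B (Some (x, y)) (Some (z, t))) c =
  (-1) ^+ (K3_par y && K3_par z) *
  (if c is Some (i, j) then coef (K3_mul B x z) i * coef (K3_mul B y t) j
   else - (3 / 4 * (K3_form B x z * K3_form B y t))).
Proof.
rewrite /K10_mul Defs.coefZ Defs.coefB Defs.coefZ coef_vec coef_ebas.
by case: c => [[i j]|] /=; rewrite ?mulr0 ?subr0 ?mulr1 ?sub0r.
Qed.

Lemma coef_smul_bas p z t c : coef (smul (A := A) p (bas z t)) c =
  coef p None * (c == Some (z, t))%:R +
  \sum_x \sum_y coef p (Some (x, y)) *
   alg_in R (coef (K10_mul B (Some (x, y)) (Some (z, t))) c).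
Proof.
have E b : \sum_d coef p b * coef (bas z t) d * alg_in R (coef (K10_mul B b d) c) =
    coef p b * alg_in R (coef (K10_mul B b (Some (z, t))) c).
  rewrite (bigD1 (Some (z, t))) //= coef_ebas eqxx mulr1 big1 ?addr0 // => d dn.
  by rewrite coef_ebas (negPf dn) mulr0 mul0r.
rewrite coef_smul; under eq_bigr do rewrite E.
rewrite big_K10; congr (_ * _ + _).
by rewrite coef_ebas rmorph_nat.
Qed.

Lemma coef_bas_smul p z t c : coef (smul (A := A) (bas z t) p) c =
  coef p None * (c == Some (z, t))%:R +
  \sum_x \sum_y coef p (Some (x, y)) *
   alg_in R (coef (K10_mul B (Some (z, t)) (Some (x, y))) c).
Proof.
rewrite coef_smul (bigD1 (Some (z, t))) //= [X in _ + X]big1 ?addr0; last first.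
  move=> d dn; apply: big1 => b _.
  by rewrite coef_ebas (negPf dn) !mul0r.
rewrite big_K10 coef_ebas eqxx !mul1r; congr (_ * _ + _).
  by rewrite coef_ebas rmorph_nat.
by apply: eq_bigr => x _; apply: eq_bigr => y _; rewrite mul1r.
Qed.

Lemma smul_hom (C : superalg F) p q (u v : sext C R) :
  homogeneous p u -> homogeneous q v -> homogeneous (p (+) q) (smul u v).
Proof.
move=> uH vH b bpq; rewrite Defs.coef_sum big1 // => x _.
rewrite Defs.coef_sum big1 // => y _; rewrite Defs.coefZ coef_vec.
have [xp|xp] := eqVneq (sa_par x) p; last by rewrite uH // !mul0r.
have [yq|yq] := eqVneq (sa_par y) q; last by rewrite (vH y) // mulr0 mul0r.
have [->|/sa_graded E] := eqVneq (coef (sa_mul x y) b) 0.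
  by rewrite rmorph0 mulr0.
by case/negP: bpq; rewrite E xp yq.
Qed.

Lemma ebas_hom (C : superalg F) (b : sa_basis C) :
  homogeneous (sa_par b) (ebas R b : sext C R).
Proof.
by move=> c cb; rewrite coef_ebas; case: (c =P b) cb => [->|//]; rewrite eqxx.
Qed.

Local Notation eps := (bas None None).

Lemma half4 : half * half * 4 = 1.
Proof.
have h := half2 char2 R; transitivity ((half * 2) * (half * 2)); first ring.
by rewrite h mulr1.
Qed.

Lemma three_quarters : alg_in R (3 / 4) = 3 * (half * half).
Proof.
by rewrite -(rmorph_nat (alg_in R) 3) -!rmorphM -invfM -natrM.
Qed.

(** Multiplication by a fixes a and halves W; as a is orthogonal to W, no multiple of 1 appears. *)
Lemma eps_odd u : odd_elt u -> smul (A := A) eps u = half *: u.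
Proof.
move=> uo; have [u0 uE uW] := odd_coef uo.
have eo : odd_elt (smul (A := A) eps u).
  exact: (smul_hom (@ebas_hom A (Some (None, None))) uo).
have [e0 eE eW] := odd_coef eo.
apply/fmodP => c; rewrite Defs.coefZ.
case: c => [[[i|] [j|]]|]; rewrite ?e0 ?eE ?eW ?u0 ?uE ?uW ?mulr0 //;
rewrite coef_bas_smul; under eq_bigr do under eq_bigr do rewrite K10_mulE !K3_mulE /=;
rewrite !big_K3 u0 uE !uW !mul0r.
  by case: (ord2P i) => -> /=; rewrite ?expr0 !(mul0r, mulr0, mul1r, mulr1, rmorph0); ring.
by case: (ord2P j) => -> /=; rewrite ?expr0 !(mul0r, mulr0, mul1r, mulr1, rmorph0); ring.
Qed.

(** On W (x) W, [eps] acts as 1/4, so 4 eps - 1 kills this part; and eps^2 = eps - 3/16 gives (4 eps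
    - 1) eps = (3/4) (4 eps - 1). *)
Lemma eps_even u : even_elt u ->
  4 *: smul (A := A) eps u - u =
  (coef u None + alg_in R (3 / 4) * coef u (Some (None, None))) *: (4 *: eps - one).
Proof.
move=> ue; have [uL uR] := even_coef ue.
have ee : even_elt (smul (A := A) eps u).
  exact: (smul_hom (@ebas_hom A (Some (None, None))) ue).
have [eL eR] := even_coef ee.
apply/fmodP => c; rewrite Defs.coefZ !Defs.coefB !Defs.coefZ !coef_ebas.
case: c => [[[i|] [j|]]|]; rewrite ?eL ?eR ?uL ?uR ?(mulr0, subr0, subrr) //;
rewrite coef_bas_smul; under eq_bigr do under eq_bigr do rewrite K10_mulE ?K3_mulE /=;
rewrite !big_K3 !uL !uR !mul0r.
- case: (ord2P i) => ->; case: (ord2P j) => -> /=;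
    rewrite ?expr0 !(mul0r, mulr0, mul1r, rmorph0, add0r, addr0) rmorphM;
  move: (coef u _) => c;
  by (transitivity (c * (half * half * 4) - c); [|rewrite half4]; ring).
- rewrite eqxx !expr0 !(mul0r, mulr0, mul1r, mulr1, rmorph0, rmorph1, add0r, addr0)
    three_quarters.
  move: (coef u None) (coef u (Some (None, None))) => c d.
  by transitivity (4 * c + 3 * d * (half * half * 4)); [rewrite half4|]; ring.
- rewrite eqxx !expr0 !(mul0r, mulr0, mul1r, mulr1, oppr0, rmorph0, add0r, addr0).
  rewrite rmorphN (rmorphM _ (3 / 4)) three_quarters rmorphM /=.
  move: (coef u None) (coef u (Some (None, None))) => c d.
  by transitivity (- (half * half * 4) * (d * (3 * (half * half))) - c);
    [|rewrite half4]; rewrite /= ?mulr1n; ring.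
Qed.

Lemma alg_in_reg (c : F) (x : R) : c != 0 -> x * alg_in R c = 0 -> x = 0.
Proof.
by move=> c0 E; rewrite -[x]mulr1 -(rmorph1 (alg_in R)) -(divff c0) rmorphM mulrA E mul0r.
Qed.

(** This coordinate sees only the W (x) W part of [p]. The next two lemmas see the coefficients of 1
    and [eps], with weights 1, 1/2 on an odd vector and 1, 1/4 on W (x) W. Together they determine
    [saut_eps]. *)
Lemma even_mul_lr p k j : even_elt p ->
  coef (smul (A := A) p (bas (Some k) None)) (Some (None, Some j)) =
  - (half * (coef p (Some (Some 0, Some j)) * alg_in R (B 0 k)
   + coef p (Some (Some 1, Some j)) * alg_in R (B 1 k))).
Proof.
move=> /even_coef[pL pR]; rewrite coef_smul_bas.
under eq_bigr do under eq_bigr do rewrite K10_mulE ?K3_mulE /=.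
rewrite !big_K3 !pL !pR; case: (ord2P j) => -> /=;
rewrite !(mulr0, mul0r, add0r, addr0, mul1r, rmorph0) expr1 !mulN1r !rmorphN !rmorphM; ring.
Qed.

Lemma even_mul_ll p k : even_elt p ->
  coef (smul (A := A) p (bas (Some k) None)) (Some (Some k, None)) =
  coef p None + half * coef p (Some (None, None)).
Proof.
move=> /even_coef[pL pR]; rewrite coef_smul_bas.
under eq_bigr do under eq_bigr do rewrite K10_mulE ?K3_mulE /=.
rewrite !big_K3 !pL !pR !eqxx expr0 /=.
by rewrite !(mulr0, mul0r, add0r, addr0, mul1r, mulr1, rmorph0) mulrC.
Qed.

Lemma even_mul_ww p k l : even_elt p ->
  coef (smul (A := A) p (bas (Some k) (Some l))) (Some (Some k, Some l)) =
  coef p None + half * half * coef p (Some (None, None)).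
Proof.
move=> /even_coef[pL pR]; rewrite coef_smul_bas.
under eq_bigr do under eq_bigr do rewrite K10_mulE ?K3_mulE /=.
rewrite !big_K3 !pL !pR !eqxx expr0 /=.
by rewrite !(mulr0, mul0r, add0r, addr0, mul1r, mulr1, rmorph0) rmorphM mulrC.
Qed.

(** * Fixed elements of an automorphism and its blocks on the odd part *)

Section AutomorphismBlocks.
Variable phi : saut A R.
Lemma sautZ k u : val phi (k *: u) = k *: val phi u.
Proof.
by have [L _ _ _] := sautP phi; have := L k u 0; rewrite (linear_zero L) !addr0.
Qed.
Lemma sautD u v : val phi (u + v) = val phi u + val phi v.
Proof. by have [L _ _ _] := sautP phi; have := L 1 u v; rewrite !scale1r. Qed.
Lemma sautB u v : val phi (u - v) = val phi u - val phi v.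
Proof. by rewrite -scaleN1r sautD sautZ scaleN1r. Qed.
Lemma sautM u v : val phi (smul u v) = smul (val phi u) (val phi v).
Proof. by have [_ _ ->] := sautP phi. Qed.
Lemma saut_homog p u : homogeneous p u -> homogeneous p (val phi u).
Proof. by have [_ _ _ H] := sautP phi; apply: H. Qed.
Lemma saut_surj p u : homogeneous p u -> exists2 v, homogeneous p v & val phi v = u.
Proof.
have [_ _ _ H] := sautP (saut_inv phi).
by move=> /H Hu; exists (val (saut_inv phi) u); rewrite // [LHS]saut_inv_funK.
Qed.

Lemma saut1 : val phi one = one.
Proof.
have [v _ E] := saut_surj (@ebas_hom A None).
by have := sautM one v; rewrite K10_one_l E K10_one_r => <-.
Qed.

Lemma saut_eps : val phi eps = eps.
Proof.
set p := val phi eps.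
have pe : even_elt p by apply: saut_homog; apply: (@ebas_hom A (Some (None, None))).
have [pL pR] := even_coef pe.
have pX u : odd_elt u -> smul (A := A) p u = half *: u.
  by move=> /saut_surj[v vo <-]; rewrite -sautM eps_odd // sautZ.
have pXE b c : K10_par b -> coef (smul (A := A) p (ebas R b)) c = half * coef (ebas R b) c.
  by move=> bo; rewrite pX ?Defs.coefZ //; have := @ebas_hom A b; rewrite /= bo.
have pW i j : coef p (Some (Some i, Some j)) = 0.
  (* The coefficient at a (x) w_j of p (w_k (x) a), with k the index other than
     i, only involves the coefficient of p at w_i (x) w_j. *)
  have := pXE (Some (Some (i == 0)%:R, None)) (Some (None, Some j)) isT.
  rewrite even_mul_lr // coef_ebas mulr0.
  have b0 := alg_in_reg B01_neq0; have h0 := alg_in_reg (invr_neq0 (two_neq0 char2)).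
  case: (ord2P i) => ->;
    rewrite /= ?B00 ?B11 ?(B10 skewB) ?rmorphN rmorph0 ?mulr0 ?addr0 ?add0r.
    by move/eqP; rewrite oppr_eq0 mulrC => /eqP/h0/b0.
  by move/eqP; rewrite oppr_eq0 mulrN mulrN oppr_eq0 mulrC => /eqP/h0/b0.
have pT : coef p None + half * coef p (Some (None, None)) = half.
  have := pXE (Some (Some 0, None)) (Some (Some 0, None)) isT.
  by rewrite even_mul_ll // coef_ebas eqxx mulr1.
(* Apply [phi] to [eps_even] at a preimage of w_0 (x) w_0. The right-hand side becomes a multiple of
   4 p - 1, which by [pW] has no W (x) W coordinate; so p acts on w_0 (x) w_0 with diagonal
   coefficient 1/4. *)
have pF : coef p None + half * half * coef p (Some (None, None)) = half * half.
  have wH := @ebas_hom A (Some (Some 0, Some 0)).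
  have [y ye yE] := saut_surj wH.
  have := congr1 (val phi) (eps_even ye).
  rewrite sautZ !sautB !sautZ sautM saut1 yE => /fmodP/(_ (Some (Some 0, Some 0))).
  rewrite !Defs.coefZ !Defs.coefB !Defs.coefZ pW !coef_ebas eqxx mulr0 subr0 mulr0.
  rewrite even_mul_ww //.
  move=> /eqP; rewrite subr_eq0 => /eqP E.
  by rewrite -[LHS]mul1r -half4 -mulrA E mulr1.
have hh2 : half = half * half * 2.
  by rewrite -mulrA (half2 char2) mulr1.
(* Subtracting [pF] from [pT] leaves d / 4 = 1 / 4 for the coefficient d at [eps], so only 2 has to
   be inverted. *)
have pE1 : coef p (Some (None, None)) = 1.
  rewrite -[LHS]mul1r -half4.
  transitivity ((half * half * 2 * coef p (Some (None, None))
    - half * half * coef p (Some (None, None))) * 4); first ring.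
  rewrite -hh2.
  transitivity (((coef p None + half * coef p (Some (None, None))) -
     (coef p None + half * half * coef p (Some (None, None)))) * 4); first ring.
  rewrite pT pF; transitivity ((half * half * 2 - half * half) * 4); first by rewrite -hh2.
  by ring.
have pN0 : coef p None = 0.
  by apply: (@addIr _ half); rewrite add0r -[RHS]pT pE1 mulr1.
apply/fmodP => c; rewrite coef_ebas.
by case: c => [[[k|] [l|]]|]; rewrite ?pL ?pR ?pW ?pE1 ?pN0.
Qed.

(** Such a [z] lies in R 1 + R eps, and both generators are fixed. *)
Lemma saut_fix z : even_elt z -> (forall i j, coef z (Some (Some i, Some j)) = 0) ->
  val phi z = z.
Proof.
move=> /even_coef[zL zR] zW.
suff -> : z = coef z None *: one + coef z (Some (None, None)) *: eps.
  by rewrite sautD !sautZ saut1 saut_eps.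
  apply/fmodP => c; rewrite Defs.coefD !Defs.coefZ !coef_ebas.
  by case: c => [[[k|] [l|]]|]; rewrite ?zL ?zR ?zW ?eqxx
    ?(mulr0, mulr1, addr0, add0r) //= ?mulr1 ?mulr0 ?add0r.
Qed.

Lemma basl_eqE i j :
  ((Some (Some j, None) == Some (Some i, None) :> K10b) = (j == i)) *
  ((Some (None, Some j) == Some (Some i, None) :> K10b) = false).
Proof. by split=> //; rewrite (inj_eq Some_inj) xpair_eqE eqxx andbT. Qed.
Lemma basr_eqE i j :
  ((Some (None, Some j) == Some (None, Some i) :> K10b) = (j == i)) *
  ((Some (Some j, None) == Some (None, Some i) :> K10b) = false).
Proof. by split=> //; rewrite (inj_eq Some_inj) xpair_eqE eqxx. Qed.

Lemma ord_lift0 : lift 0 0 = 1 :> 'I_2.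
Proof. exact: val_inj. Qed.

(* The matrix of phi on the odd part (W (x) a) + (a (x) W) has the block columns
   (blk_ll, blk_rl) and (blk_lr, blk_rr). *)
Definition blk_ll : 'M[R]_2 :=
  \matrix_(i, j) coef (val phi (bas (Some j) None)) (Some (Some i, None)).
Definition blk_rl : 'M[R]_2 :=
  \matrix_(i, j) coef (val phi (bas (Some j) None)) (Some (None, Some i)).
Definition blk_lr : 'M[R]_2 :=
  \matrix_(i, j) coef (val phi (bas None (Some j))) (Some (Some i, None)).
Definition blk_rr : 'M[R]_2 :=
  \matrix_(i, j) coef (val phi (bas None (Some j))) (Some (None, Some i)).

Lemma odd_bas_l i : odd_elt (bas (Some i) None).
Proof. exact: (@ebas_hom A (Some (Some i, None))). Qed.
Lemma odd_bas_r i : odd_elt (bas None (Some i)).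
Proof. exact: (@ebas_hom A (Some (None, Some i))). Qed.

(** At indices 0 and 1, [B 0 1] times this is the coordinate at a (x) a of the product of two odd
    elements, by [odd_mul]. *)
Definition odd_form (a b : 'I_2) (u v : fmod R K10b) : R :=
    coef u (Some (Some a, None)) * coef v (Some (Some b, None))
    - coef u (Some (Some b, None)) * coef v (Some (Some a, None))
    + (coef u (Some (None, Some a)) * coef v (Some (None, Some b))
    - coef u (Some (None, Some b)) * coef v (Some (None, Some a))).

Lemma odd_form_basl a b : a != b -> odd_form a b (bas (Some a) None) (bas (Some b) None) = 1.
Proof.
move=> /negPf ab; have ba : b == a = false by rewrite eq_sym.
transitivity (1 * 1 - 0 * 0 + (0 * 0 - 0 * 0) : R); last by ring.
by congr (_ * _ - _ * _ + (_ * _ - _ * _)); rewrite coef_ebas basl_eqE ?eqxx ?ab ?ba.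
Qed.
Lemma odd_form_basr a b : a != b -> odd_form a b (bas None (Some a)) (bas None (Some b)) = 1.
Proof.
move=> /negPf ab; have ba : b == a = false by rewrite eq_sym.
transitivity (0 * 0 - 0 * 0 + (1 * 1 - 0 * 0) : R); last by ring.
by congr (_ * _ - _ * _ + (_ * _ - _ * _)); rewrite coef_ebas basr_eqE ?eqxx ?ab ?ba.
Qed.
Lemma basl_cross a b i j :
  coef (bas (Some a) None) (Some (Some i, None))
    * coef (bas (Some b) None) (Some (None, Some j))
  = coef (bas (Some a) None) (Some (None, Some j))
    * coef (bas (Some b) None) (Some (Some i, None)).
Proof.
have z c : coef (bas (Some c) None) (Some (None, Some j)) = 0 by rewrite coef_ebas basl_eqE.
by transitivity (0 : R); [rewrite [X in _ * X]z mulr0 | rewrite [X in X * _]z mul0r].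
Qed.
Lemma basr_cross a b i j :
  coef (bas None (Some a)) (Some (Some i, None))
    * coef (bas None (Some b)) (Some (None, Some j))
  = coef (bas None (Some a)) (Some (None, Some j))
    * coef (bas None (Some b)) (Some (Some i, None)).
Proof.
have z c : coef (bas None (Some c)) (Some (Some i, None)) = 0 by rewrite coef_ebas basr_eqE.
by transitivity (0 : R); [rewrite [X in X * _]z mul0r | rewrite [X in _ * X]z mulr0].
Qed.

(* The hypothesis says that the W (x) W-component of the product of u and v
   vanishes, so that this product is fixed by phi. *)
Lemma saut_odd_rel u v : odd_elt u -> odd_elt v ->
  (forall i j, coef u (Some (Some i, None)) * coef v (Some (None, Some j))
    = coef u (Some (None, Some j)) * coef v (Some (Some i, None))) ->
  odd_form 0 1 (val phi u) (val phi v) = odd_form 0 1 u v /\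
  (forall i j,
    coef (val phi u) (Some (Some i, None)) * coef (val phi v) (Some (None, Some j))
    = coef (val phi u) (Some (None, Some j)) * coef (val phi v) (Some (Some i, None))).
Proof.
move=> uo vo uv.
have uo' : odd_elt (val phi u) by apply: saut_homog.
have vo' : odd_elt (val phi v) by apply: saut_homog.
have [zN zW] := odd_mul uo vo; have [wN wW] := odd_mul uo' vo'.
have zW0 i j : coef (smul (A := A) u v) (Some (Some i, Some j)) = 0.
  by rewrite zW uv subrr mulr0.
have zE := saut_fix (smul_hom (C := A) uo vo) zW0.
rewrite sautM in zE; rewrite zE in wN wW; split=> [|i j].
  apply/eqP; rewrite -subr_eq0; apply/eqP/(alg_in_reg B01_neq0).
  by rewrite mulrC mulrBr /odd_form -zN -wN subrr.
apply/eqP; rewrite -subr_eq0; apply/eqP.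
by rewrite -[LHS]mul1r -half4 mulrAC -wW zW0 mul0r.
Qed.

Lemma blk_l_rel : \det blk_ll + \det blk_rl = 1 /\
  forall i j, blk_ll i 0 * blk_rl j 1 = blk_rl j 0 * blk_ll i 1.
Proof.
have [E1 E2] := saut_odd_rel (odd_bas_l 0) (odd_bas_l 1) (basl_cross 0 1).
split=> [|i j]; last by rewrite !mxE E2.
rewrite !det2 !mxE -(@odd_form_basl 0 1) // -E1.
by congr (_ - _ + (_ - _)); rewrite mulrC.
Qed.

Lemma blk_r_rel : \det blk_rr + \det blk_lr = 1 /\
  forall i j, blk_rr i 0 * blk_lr j 1 = blk_lr j 0 * blk_rr i 1.
Proof.
have [E1 E2] := saut_odd_rel (odd_bas_r 0) (odd_bas_r 1) (basr_cross 0 1).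
split=> [|i j]; last by rewrite !mxE -E2.
rewrite !det2 !mxE -(@odd_form_basr 0 1) // -E1 addrC.
by congr (_ - _ + (_ - _)); rewrite mulrC.
Qed.
End AutomorphismBlocks.

(** The minor of any row of [f] with any row of [h] vanishes. Cramer's rule det(f_0, f_1) h_j =
    det(h_j, f_1) f_0 + det(f_0, h_j) f_1, for rows, then makes [\det f] kill [h], and
    symmetrically. *)
Lemma rank1_det (f h : 'M[R]_2) : \det f + \det h = 1 ->
  (forall i j, f i 0 * h j 1 = h j 0 * f i 1) ->
  [/\ forall i j, \det f * h i j = 0, forall i j, \det h * f i j = 0
    & \det f * \det h = 0].
Proof.
move=> dE E.
have fh i j : \det f * h i j = 0.
  rewrite det2; case: (ord2P j) => ->.
    transitivity (f 0 0 * (h i 0 * f 1 1) - f 1 0 * (h i 0 * f 0 1)); first ring.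
    rewrite -!E; ring.
  transitivity (f 1 1 * (f 0 0 * h i 1) - f 0 1 * (f 1 0 * h i 1)); first ring.
  rewrite !E; ring.
split=> // [i j|].
  rewrite det2; case: (ord2P j) => ->.
    transitivity (h 0 0 * (f i 0 * h 1 1) - h 1 0 * (f i 0 * h 0 1)); first ring.
    rewrite !E; ring.
  transitivity (h 1 1 * (h 0 0 * f i 1) - h 0 1 * (h 1 0 * f i 1)); first ring.
  rewrite -!E; ring.
by rewrite [X in _ * X]det2 mulrBr !mulrA !fh !mul0r subrr.
Qed.

(** * Complementary idempotents attached to an automorphism *)

Section SecondComponent.
Variable phi : saut A R.
Local Notation f := (blk_ll phi).
Local Notation h := (blk_rl phi).
Local Notation k := (blk_lr phi).
Local Notation g := (blk_rr phi).

Lemma odd_expand u c : odd_elt u -> coef (val phi u) c =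
  \sum_i (coef u (Some (Some i, None)) * coef (val phi (bas (Some i) None)) c
         + coef u (Some (None, Some i)) * coef (val phi (bas None (Some i))) c).
Proof.
move=> /odd_coef[u0 uE uW]; have [L _ _ _] := sautP phi.
have E (w : K10b -> R) : \sum_b coef u b * w b =
    \sum_i (coef u (Some (Some i, None)) * w (Some (Some i, None))
            + coef u (Some (None, Some i)) * w (Some (None, Some i))).
  rewrite big_K10 !big_K3 u0 uE !uW !mul0r !(add0r, addr0).
  by rewrite big_ord_recl big_ord1 ord_lift0 [RHS]addrACA addrC.
by rewrite (linear_lext L u) coef_lext E.
Qed.

(* Where both det f and det k are invertible, h and g vanish and phi maps the odd
   part into W (x) a, against surjectivity. *)
Lemma blk_cross : \det f * \det k = 0 /\ \det h * \det g = 0.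
Proof.
have [Lf Lh] := blk_l_rel phi; have [Rg Rk] := blk_r_rel phi.
have [fh hf _] := rank1_det Lf Lh; have [gk kg _] := rank1_det Rg Rk.
split.
  (* The coordinate of [val phi u] at a (x) w_0 writes 1 as a combination of entries of [h], killed
     by [\det f], and of [g], killed by [\det k]. *)
  have [u uo E] := saut_surj phi (odd_bas_r 0).
  have E1 := esym (odd_expand (Some (None, Some 0)) uo); rewrite E coef_ebas eqxx in E1.
  rewrite -[LHS]mulr1 -[X in _ * X = _]E1 mulr_sumr big1 // => i _.
  have := fh 0 i; have := kg 0 i; rewrite !mxE => kg0 fh0.
  rewrite mulrDr [X in X + _]mulrCA [X in _ + X]mulrCA.
  by rewrite -[X in _ + _ * X]mulrA kg0 [X in _ * X + _]mulrAC fh0 !(mul0r, mulr0) addr0.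
have [u uo E] := saut_surj phi (odd_bas_l 0).
have E1 := esym (odd_expand (Some (Some 0, None)) uo); rewrite E coef_ebas eqxx in E1.
rewrite -[LHS]mulr1 -[X in _ * X = _]E1 mulr_sumr big1 // => i _.
have := hf 0 i; have := gk 0 i; rewrite !mxE => gk0 hf0.
rewrite mulrDr [X in X + _]mulrCA [X in _ + X]mulrCA.
by rewrite -[X in _ + _ * X]mulrA gk0 [X in _ * X + _]mulrAC hf0 !(mul0r, mulr0) addr0.
Qed.

Lemma cpoint2_subproof (a b : R) : a + b = 1 -> a * b = 0 ->
  is_point [ffun i : 'Z_2 => if i == 0 then a else b].
Proof.
move=> ab1 ab0; apply/is_pointP; split=> [i j|]; last by rewrite Z2_sum !ffunE.
have aa : a * a = a by rewrite -[RHS]mulr1 -ab1 mulrDr ab0 addr0.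
have bb : b * b = b by rewrite -[RHS]mulr1 -ab1 mulrDr [b * a]mulrC ab0 add0r.
rewrite !ffunE; case: (ord2P i) => ->; case: (ord2P j) => -> //=.
by rewrite mulrC.
Qed.
Definition cpoint2 (a b : R) (ab1 : a + b = 1) (ab0 : a * b = 0) : cpoint 'Z_2 R :=
  exist (@is_point 'Z_2 R) _ (cpoint2_subproof ab1 ab0).

Lemma blk_orth : \det f * \det h = 0.
Proof. by have [Lf Lh] := blk_l_rel phi; have [] := rank1_det Lf Lh. Qed.

(** Each pair of determinants sums to 1, so by the orthogonality in [blk_cross] both [\det g] and
    [\det f] equal their product; likewise for [\det k] and [\det h]. *)
Lemma blk_det : \det g = \det f /\ \det k = \det h.
Proof.
have [Lf _] := blk_l_rel phi; have [Rg _] := blk_r_rel phi.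
have [fk hg] := blk_cross.
split.
  transitivity (\det f * \det g).
    by rewrite -[LHS]mul1r -Lf mulrDl hg addr0.
  by rewrite -[RHS]mulr1 -Rg mulrDr fk addr0.
transitivity (\det h * \det k).
  by rewrite -[LHS]mul1r -Lf mulrDl fk add0r.
by rewrite -[RHS]mulr1 -Rg mulrDr hg add0r.
Qed.

Lemma blk_kill : [/\ forall i j, \det f * h i j = 0, forall i j, \det f * k i j = 0,
  forall i j, \det h * f i j = 0 & forall i j, \det h * g i j = 0].
Proof.
have [Lf Lh] := blk_l_rel phi; have [Rg Rk] := blk_r_rel phi.
have [fh hf _] := rank1_det Lf Lh; have [gk kg _] := rank1_det Rg Rk.
by have [Eg Ek] := blk_det; rewrite Eg in gk; rewrite Ek in kg.
Qed.

Lemma blk_idem (M : 'M[R]_2) : (forall i j, \det h * M i j = 0) ->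
  forall i j, \det f * M i j = M i j.
Proof.
move=> hM i j; have [Lf _] := blk_l_rel phi.
by rewrite -[RHS]mul1r -Lf mulrDl hM addr0.
Qed.
Lemma blk_idem' (M : 'M[R]_2) : (forall i j, \det f * M i j = 0) ->
  forall i j, \det h * M i j = M i j.
Proof.
move=> hM i j; have [Lf _] := blk_l_rel phi.
by rewrite -[RHS]mul1r -Lf mulrDl hM add0r.
Qed.

Lemma det_sum_orth (M N : 'M[R]_2) : (forall i j k l, M i j * N k l = 0) ->
  \det (M + N) = \det M + \det N.
Proof.
move=> MN; rewrite !det2 !mxE.
transitivity (M 0 0 * M 1 1 - M 0 1 * M 1 0 + (N 0 0 * N 1 1 - N 0 1 * N 1 0)
  + (M 0 0 * N 1 1 + M 1 1 * N 0 0 - M 0 1 * N 1 0 - M 1 0 * N 0 1)); first ring.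
by rewrite !MN !subr0 !addr0.
Qed.

Lemma blk_orth2 (M N : 'M[R]_2) : (forall i j, \det h * M i j = 0) ->
  (forall i j, \det f * N i j = 0) -> forall i j k l, M i j * N k l = 0.
Proof.
by move=> hM fN i j p q; rewrite -(blk_idem hM) mulrAC fN mul0r.
Qed.

Lemma blk_detl : \det (f + k) == 1.
Proof.
have [fh fk hf hg] := blk_kill; have [Lf _] := blk_l_rel phi.
by rewrite (det_sum_orth (blk_orth2 hf fk)) blk_det.2 Lf.
Qed.
Lemma blk_detr : \det (g + h) == 1.
Proof.
have [fh fk hf hg] := blk_kill; have [Lf _] := blk_l_rel phi.
by rewrite (det_sum_orth (blk_orth2 hg fh)) blk_det.1 Lf.
Qed.
End SecondComponent.

(** * Bijectivity of [Phi] on points *)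

Lemma Phi_coef (F1 G1 : slmx 2 R) (e : cpoint 'Z_2 R) :
  let x : SL2xSL2_C2 F R := ((F1, G1), e) in
  let phi := Phi_fun char2 skewB x in
  [/\ blk_ll phi = val e 0 *: val F1, blk_rl phi = val e 1 *: val G1,
      blk_lr phi = val e 1 *: val F1 & blk_rr phi = val e 0 *: val G1].
Proof.
(* On the odd part [tau] exchanges the two summands without a sign, which puts the [val e 1] terms
   into the off-diagonal blocks. *)
have E b : val (Phi_fun char2 skewB (((F1, G1), e) : SL2xSL2_C2 F R)) (ebas R b) =
  val e 0 *: phi_basis (val F1) (val G1) b
  + val e 1 *: lext (phi_basis (val F1) (val G1)) (tau_basis R b).
  by rewrite /= lext_ebas lextD !lextZ lext_ebas.
split; apply/matrixP => i j; rewrite !mxE E /= scale1r lext_ebas Defs.coefD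
  !Defs.coefZ !coef_phi /= !coef_vec; by rewrite /= ?(mulr0, mul0r, mulr1, mul1r, addr0, add0r).
Qed.

(** Automorphisms fix 1 and [eps], and w_i (x) w_j = 4 (w_i (x) a)(a (x) w_j) is generated by the
    odd part. *)
Lemma saut_odd_ext (phi psi : saut A R) :
  (forall i, val phi (bas (Some i) None) = val psi (bas (Some i) None)) ->
  (forall i, val phi (bas None (Some i)) = val psi (bas None (Some i))) -> phi = psi.
Proof.
move=> El Er; apply: saut_ext => -[[[i|] [j|]]|] //; rewrite ?saut_eps ?saut1 //.
have -> : bas (Some i) (Some j) = 4 *: smul (A := A) (bas (Some i) None) (bas None (Some j)).
  rewrite smul_ebas; apply/fmodP => c; rewrite Defs.coefZ coef_ebas coef_vec K10_mulE.
  case: c => [[x y]|]; last first.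
    by rewrite /= expr0 mul1r mul0r (mulr0 (3 / 4)) oppr0 (rmorph0 (alg_in R)) (mulr0 4).
  rewrite (inj_eq Some_inj) xpair_eqE !K3_mulE.
  case: x y => [x|] [y|]; rewrite /= ?(mul0r, mulr0, rmorph0) ?mulr0 ?andbF //.
  rewrite !(inj_eq Some_inj) expr0 mul1r mulrACA -natrM mulnb rmorphM rmorph_nat.
  by rewrite [RHS]mulrC -mulrA rmorphM half4 mulr1.
by rewrite !sautZ !sautM El Er.
Qed.

Lemma saut_blk_ext (phi psi : saut A R) : blk_ll phi = blk_ll psi ->
  blk_rl phi = blk_rl psi -> blk_lr phi = blk_lr psi -> blk_rr phi = blk_rr psi ->
  phi = psi.
Proof.
move=> /matrixP E1 /matrixP E2 /matrixP E3 /matrixP E4; apply: saut_odd_ext => i;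
apply/fmodP => c.
  have /odd_coef[p0 pE pW] := saut_homog phi (odd_bas_l i).
  have /odd_coef[q0 qE qW] := saut_homog psi (odd_bas_l i).
  case: c => [[[x|] [y|]]|]; rewrite ?p0 ?pE ?pW ?q0 ?qE ?qW //.
    by have := E1 x i; rewrite !mxE.
  by have := E2 y i; rewrite !mxE.
have /odd_coef[p0 pE pW] := saut_homog phi (odd_bas_r i).
have /odd_coef[q0 qE qW] := saut_homog psi (odd_bas_r i).
case: c => [[[x|] [y|]]|]; rewrite ?p0 ?pE ?pW ?q0 ?qE ?qW //.
  by have := E3 x i; rewrite !mxE.
by have := E4 y i; rewrite !mxE.
Qed.

Lemma Phi_surj (phi : saut A R) :
  exists x : SL2xSL2_C2 F R, Phi_fun char2 skewB x = phi.
Proof.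
pose F1 : slmx 2 R := exist (fun M : 'M_2 => \det M == 1) _ (blk_detl phi).
pose G1 : slmx 2 R := exist (fun M : 'M_2 => \det M == 1) _ (blk_detr phi).
pose e := cpoint2 (blk_l_rel phi).1 (blk_orth phi).
have [fh fk hf hg] := blk_kill phi.
exists ((F1, G1), e); have [E1 E2 E3 E4] := Phi_coef F1 G1 e.
apply: saut_blk_ext; rewrite ?E1 ?E2 ?E3 ?E4 /=; apply/matrixP => i j;
  rewrite [LHS]mxE [X in _ * X]mxE ffunE /= mulrDr ?fk ?fh ?hf ?hg ?addr0 ?add0r;
  by rewrite ?(blk_idem hf) ?(blk_idem hg) ?(blk_idem' fh) ?(blk_idem' fk).
Qed.

(** The blocks of [Phi_coef] determine the point: those carrying [F1] add up to [F1], those carrying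
    [G1] to [G1], and the determinant of [val e i *: val F1] is e_i^2 = e_i. *)
Lemma Phi_inj : injective (@Phi_fun F B char2 skewB R).
Proof.
move=> [[F1 G1] e] [[F2 G2] e'] E.
have [E1 E2 E3 E4] := Phi_coef F1 G1 e.
have := Phi_coef F2 G2 e'; rewrite /= -E E1 E2 E3 E4 => -[H1 H2 H3 H4].
have S (c : cpoint 'Z_2 R) (M : 'M[R]_2) : M = val c 0 *: M + val c 1 *: M.
  by rewrite -scalerDl pt_sum scale1r.
have FE : F1 = F2 :> slmx 2 R.
  by apply: val_inj; rewrite [LHS](S e) [RHS](S e') H1 H3.
have GE : G1 = G2 :> slmx 2 R.
  by apply: val_inj; rewrite [LHS](S e) [RHS](S e') H2 H4.
have D (M : slmx 2 R) (c : cpoint 'Z_2 R) i : val c i = \det (val c i *: val M).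
  by rewrite detZ (eqP (valP M)) mulr1 expr2 pt_sqr.
have e0 : val e 0 = val e' 0 by rewrite (D F1) H1 -D.
have e1 : val e 1 = val e' 1 by rewrite (D F1) H3 -D.
congr (_, _, _) => //; apply: val_inj; apply/ffunP => i.
by case: (ord2P i) => ->.
Qed.

End ScalarExtension.
End KacAut.

(** * Hilbert 90 for GL_n over a field extension *)

Section Functionals.
Variables (F K : fieldType) (iota : {rmorphism F -> K}).
Local Notation L := (@ComAlg F K iota : comAlg F).

Record functional := Functional {
  fun_of_functional :> K -> F;
  functionalD : forall x y,
    fun_of_functional (x + y) = fun_of_functional x + fun_of_functional y;
  functionalZ : forall c x,
    fun_of_functional (iota c * x) = c * fun_of_functional x }.

(** Together with [U 0] this defines an F-subspace; by itself it also holds of the empty set. *)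
Definition comb_closed (U : K -> Prop) : Prop :=
  forall c y z, U y -> U z -> U (y + iota c * z).

Fixpoint inspan (s : seq K) (y : K) : Prop :=
  if s is v :: s' then exists c, inspan s' (y - iota c * v) else y = 0.

Lemma inspan_comb s : comb_closed (inspan s).
Proof.
elim: s => [|v s IHs] c y z /=; first by move=> -> ->; rewrite mulr0 addr0.
move=> [a ya] [b zb]; exists (a + c * b).
rewrite rmorphD rmorphM.
have -> : y + iota c * z - (iota a + iota c * iota b) * v =
  (y - iota a * v) + iota c * (z - iota b * v) by ring.
exact: IHs.
Qed.
Lemma inspan0 s : inspan s 0.
Proof. by elim: s => //= v s IHs; exists 0; rewrite rmorph0 mul0r subrr. Qed.
Lemma inspan_mem s v : v \in s -> inspan s v.
Proof.
elim: s => //= u s IHs; rewrite inE => /predU1P[->|/IHs vs].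
  by exists 1; rewrite rmorph1 mul1r subrr; apply: inspan0.
by exists 0; rewrite rmorph0 mul0r subr0.
Qed.

(** Zorn's lemma, as [K] may have infinite dimension over F. *)
Lemma maximal_avoiding (s : seq K) x : ~ inspan s x ->
  exists U : K -> Prop, [/\ comb_closed U, (forall v, v \in s -> U v), ~ U x, U 0
    & forall V : K -> Prop, comb_closed V -> (forall y, U y -> V y) -> ~ V x ->
      forall y, V y -> U y].
Proof.
move=> sx.
(* The last clause is conditional on U being nonempty because Zorn_bigcup also
   requires P of the union of the empty chain. *)
pose P (U : K -> Prop) := [/\ comb_closed U, ~ U x
  & forall y v, U y -> inspan s v -> U v].
have [|U [[Uc Ux Us] Umax]] := @classical_sets.Zorn_bigcup K P.
  move=> C CP Ctot; split.
  - move=> c y z [Y CY Yy] [Z CZ Zz].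
    have [YZ|ZY] := Ctot _ _ CY CZ.
      by exists Z => //; have [Zc _ _] := CP _ CZ; apply: Zc => //; apply: YZ.
    by exists Y => //; have [Yc _ _] := CP _ CY; apply: Yc => //; apply: ZY.
  - by move=> [X CX Xx]; have [_ /(_ Xx)] := CP _ CX.
  - move=> y v [Y CY Yy] sv; exists Y => //.
    by have [_ _ /(_ y v Yy sv)] := CP _ CY.
(* An empty maximal [U] would be properly contained in [inspan s]. *)
have U0 : U 0.
  apply: contrapT => nU0; apply: (Umax (inspan s)); last first.
    by split=> //; apply: inspan_comb.
  split=> [y Uy|sU].
    by case: nU0; apply: (Us _ _ Uy); apply: inspan0.
  by apply: nU0; apply: sU; apply: inspan0.
exists U; split=> //.
  by move=> v /inspan_mem; apply: Us U0.
move=> V Vc UV Vx y Vy; apply: contrapT => nUy.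
apply: (Umax V); split=> //.
  by move=> VU; apply: nUy; apply: VU.
by move=> z v _ sv; apply: UV; apply: Us U0 sv.
Qed.

(** A maximal subspace U avoiding x is a complement of the line F x; [theta] is the coordinate along
    x with kernel U. *)
Lemma separating_functional (s : seq K) x : ~ inspan s x ->
  exists theta : functional, theta x = 1 /\ forall v, v \in s -> theta v = 0.
Proof.
move=> /maximal_avoiding[U [Uc Us Ux U0 Umax]].
have UZ c y : U y -> U (iota c * y) by move=> Uy; rewrite -[_ * _]add0r; apply: Uc.
have ex y : exists c, U (y - iota c * x).
  have [Uy|nUy] := pselect (U y); first by exists 0; rewrite rmorph0 mul0r subr0.
  (* This is U + F y. By maximality it contains x, so x = c y modulo U with c nonzero, and y can be
     solved for. *)
  pose V z := exists c, U (z - iota c * y).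
  have Vx : V x.
    apply: contrapT => nVx; apply: nUy; apply: (Umax V) => //.
    - move=> c z w [a za] [b wb]; exists (a + c * b); rewrite rmorphD rmorphM.
      have -> : z + iota c * w - (iota a + iota c * iota b) * y =
        (z - iota a * y) + iota c * (w - iota b * y) by ring.
      exact: Uc.
    - by move=> z Uz; exists 0; rewrite rmorph0 mul0r subr0.
    - by exists 1; rewrite rmorph1 mul1r subrr.
  case: Vx => c Uc'.
  have c0 : c != 0 by apply: contra_notN Ux => /eqP c0; rewrite c0 rmorph0 mul0r subr0 in Uc'.
  exists c^-1.
  have -> : y - iota c^-1 * x = iota (- c^-1) * (x - iota c * y).
    rewrite rmorphN mulNr mulrBr mulrA -rmorphM mulVf // rmorph1 mul1r; ring.
  exact: UZ.
have uniq y c d : U (y - iota c * x) -> U (y - iota d * x) -> c = d.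
  move=> Uyc Uyd; apply/eqP; rewrite -subr_eq0; apply: contra_notT Ux => cd.
  have := UZ (c - d)^-1 _ (Uc (-1) _ _ Uyd Uyc).
  rewrite rmorphN rmorph1.
  have -> : y - iota d * x + -1 * (y - iota c * x) = iota (c - d) * x.
    by rewrite rmorphB; ring.
  by rewrite mulrA -rmorphM mulVf // rmorph1 mul1r.
pose theta y := projT1 (cid (ex y)).
have thetaP y : U (y - iota (theta y) * x) := projT2 (cid (ex y)).
have thetaD y z : theta (y + z) = theta y + theta z.
  apply: (uniq (y + z)) => //.
  have := Uc 1 _ _ (thetaP y) (thetaP z); rewrite rmorph1 mul1r rmorphD.
  by rewrite mulrDl opprD addrACA.
have thetaZ c y : theta (iota c * y) = c * theta y.
  apply: (uniq (iota c * y)) => //.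
  by have := UZ c _ (thetaP y); rewrite mulrBr mulrA -rmorphM.
exists (Functional thetaD thetaZ); split=> /= [|v sv].
  by apply: (uniq x) => //; rewrite rmorph1 mul1r subrr.
by apply: (uniq v) => //; rewrite rmorph0 mul0r subr0; apply: Us.
Qed.

(** * Contraction of the first tensor slot by a functional *)

Section Contraction.
Variable theta : functional.

Definition contract_fun (x y : L) : L := alg_in L (theta x) * y.

Lemma contract_balanced : balanced contract_fun.
Proof.
rewrite /contract_fun; split=> [x x' y|x y y'|c x y].
- by rewrite functionalD rmorphD mulrDl.
- by rewrite mulrDr.
- by rewrite functionalZ rmorphM mulrAC mulrC.
Qed.

Definition contract : L2 L -> L := tens_lift contract_fun.

Lemma contract_pure x y : contract (pure x y) = alg_in L (theta x) * y.
Proof. exact: tens_lift_pure contract_balanced. Qed.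
Lemma contractD : {morph contract : u v / u + v}.
Proof. exact: tens_liftD contract_balanced. Qed.
Lemma contract_zmod : zmod_morphism contract.
Proof. by move=> u v; apply/esym/eqP; rewrite subr_eq -contractD subrK. Qed.
HB.instance Definition _ := GRing.isZmodMorphism.Build (L2 L) L contract contract_zmod.

Definition contract3_fun (u : L2 L) (z : L) : L2 L := pure (contract u) z.

Lemma contract3_balanced : balanced contract3_fun.
Proof.
have [pDl pDr pc] := pure_balanced L L.
rewrite /contract3_fun; split=> [u u' z|u z z'|c u z].
- by rewrite contractD pDl.
- by rewrite pDr.
- have -> : contract (alg_in (L2 L) c * u) = alg_in L c * contract u.
    elim/tens_ind: u => t; rewrite mulr_sumr !raddf_sum mulr_sumr.
    apply: eq_bigr => p _ /=; rewrite /tens_in pureM !contract_pure mul1r /=.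
    by rewrite (functionalZ theta) rmorphM mulrA.
  by rewrite -pc.
Qed.
Definition contract3 : L3 L -> L2 L := tens_lift contract3_fun.
Lemma contract3_pure (u : L2 L) (z : L) :
  contract3 (@pure F (L2 L) L u z) = @pure F L L (contract u) z.
Proof. exact: tens_lift_pure contract3_balanced. Qed.
Lemma contract3D : {morph contract3 : u v / u + v}.
Proof. exact: tens_liftD contract3_balanced. Qed.
Lemma contract3_zmod : zmod_morphism contract3.
Proof. by move=> u v; apply/esym/eqP; rewrite subr_eq -contract3D subrK. Qed.
HB.instance Definition _ := GRing.isZmodMorphism.Build (L3 L) (L2 L) contract3 contract3_zmod.

(** On pure tensors, x (x) 1 (x) y goes to theta(x) (x) y = 1 (x) theta(x) y. *)
Lemma contract3_d2_1 (m : L2 L) : contract3 (d2_1 L m) = d1_0 L (contract m).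
Proof.
have [pDl pDr pc] := pure_balanced L L.
elim/tens_ind: m => t; rewrite !raddf_sum; apply: eq_bigr => p _ /=.
rewrite /contract3 tens_lift_pure; last exact: contract3_balanced.
rewrite /contract3_fun /contract_fun /tinl_fun /tinr_fun !contract_pure mulr1.
by have := pc (theta p.1) 1 p.2; rewrite mulr1.
Qed.

(** Slot 0 of [d2_0 L a] is 1, so theta meets only [m]: the tensor q_1 (x) p_1 q_2 (x) p_2 goes to
    theta(q_1) p_1 q_2 (x) p_2. *)
Lemma contract3_d2_02 (a m : L2 L) :
  contract3 (d2_0 L a * d2_2 L m) = a * d1_1 L (contract m).
Proof.
elim/tens_ind: a => s; elim/tens_ind: m => t.
rewrite (rmorph_sum (d2_0 L)) (rmorph_sum (d2_2 L)) (raddf_sum contract).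
rewrite (rmorph_sum (d1_1 L)) !mulr_suml (raddf_sum contract3); apply: eq_bigr => p _.
rewrite !mulr_sumr (raddf_sum contract3); apply: eq_bigr => q _.
have -> : d2_0 L (pure p.1 p.2) = @pure F (L2 L) L (@pure F L L 1 p.1) p.2.
  exact: tmap_pure.
rewrite -[d2_2 L _]/(@pure F (L2 L) L (@pure F L L q.1 q.2) 1) !pureM mul1r mulr1.
transitivity (@pure F L L (contract (pure q.1 (p.1 * q.2))) p.2).
  exact: contract3_pure.
rewrite (contract_pure q.1).
transitivity (@pure F L L (p.1 * (alg_in L (theta q.1) * q.2)) p.2).
  by congr pure; rewrite mulrCA.
by congr (pure (_ * _) _); apply/esym/contract_pure.
Qed.
End Contraction.

(** Expanding x in the first factors of t and moving the scalars across the tensor sign absorbs x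
    (x) y into the other terms. The preserved length drives the induction in [tensor_eq0]. *)
Lemma inspan_shorten (t : seq (K * K)) x y : inspan [seq p.1 | p <- t] x ->
  exists2 t' : seq (K * K), size t' = size t &
  @pure F L L x y + \sum_(p <- t) @pure F L L p.1 p.2 = \sum_(p <- t') @pure F L L p.1 p.2.
Proof.
have [pDl pDr pc] := pure_balanced L L.
elim: t x => [|[v w] t IHt] x /=.
  by move=> ->; exists [::] => //; rewrite !big_nil addr0 (balanced0l _ (pure_balanced L L)).
move=> [c /IHt[t' st' E]]; exists ((v, iota c * y + w) :: t'); first by rewrite /= st'.
rewrite !big_cons /= -E pDr -(pc c v y) /=.
rewrite [RHS]addrACA -pDl [X in _ = pure X _ + _]addrC.
by congr (pure _ _ + _); exact/esym/subrK.
Qed.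

(** Induction on the number of terms. If the leading first factor is independent of the others, a
    functional equal to 1 on it and 0 on them shows that its partner is 0; otherwise the sum can be
    shortened. *)
Lemma tensor_eq0 (z : L2 L) :
  (forall theta : functional, contract theta z = 0) -> z = 0.
Proof.
elim/tens_ind: z => t; move: {2}(size t) (erefl (size t)) => n.
elim: n t => [|n IHn] [|[x y] t] //=; rewrite ?big_nil // => -[st] H.
have [xs|/separating_functional[theta [tx ts]]] := pselect (inspan [seq p.1 | p <- t] x).
  have [t' st' E] := inspan_shorten y xs.
  by rewrite big_cons E in H *; apply: IHn; rewrite ?st'.
have y0 : y = 0.
  have := H theta; rewrite big_cons raddfD /= contract_pure tx rmorph1 mul1r.
  rewrite raddf_sum big_seq big1 ?addr0 // => p pt.
  by rewrite /= contract_pure ts ?rmorph0 ?mul0r // map_f.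
have p0 : @pure F L L x y = 0.
  have [_ pDr _] := pure_balanced L L.
  by apply: (@addrI _ (pure x y)); rewrite -pDr y0 !addr0.
by rewrite big_cons p0 add0r in H *; apply: IHn.
Qed.

Lemma contract_d1_0 (theta : functional) (r : L) (m : L2 L) :
  contract theta (d1_0 L r * m) = r * contract theta m.
Proof.
elim/tens_ind: m => t; rewrite mulr_sumr !(raddf_sum (contract theta)) mulr_sumr.
apply: eq_bigr => p _.
by rewrite [d1_0 L r]/= /tinr_fun pureM mul1r /= !contract_pure mulrCA.
Qed.

(** Contraction by a functional with theta(1) = 1 is a left inverse. *)
Lemma d1_0_inj (x : L) : d1_0 L x = 0 -> x = 0.
Proof.
have sp : ~ inspan [::] (1 : K) by move=> /eqP; rewrite oner_eq0.
have [theta [t1 _]] := separating_functional sp.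
move=> /(congr1 (contract theta)); rewrite raddf0 /= /tinr_fun contract_pure.
by rewrite t1 rmorph1 mul1r.
Qed.

(** * Descent along a matrix cocycle *)

Section Hilbert90.
Variables (n : nat) (M M' : 'M[L2 L]_n).
Hypothesis MM' : M *m M' = 1%:M.
Hypothesis M_cocycle : map_mx (d2_0 L) M *m map_mx (d2_2 L) M = map_mx (d2_1 L) M.

Definition contract_mx (theta : functional) : 'M[K]_n := \matrix_(i, j) contract theta (M i j).

Lemma contract_mx_descent theta :
  M *m map_mx (d1_1 L) (contract_mx theta) = map_mx (d1_0 L) (contract_mx theta).
Proof.
apply/matrixP => i j; rewrite !mxE -contract3_d2_1.
have /matrixP/(_ i j) := M_cocycle; rewrite !mxE => <-.
rewrite (raddf_sum (contract3 theta)); apply: eq_bigr => k _.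
by rewrite !mxE; exact/esym/contract3_d2_02.
Qed.

(** All contractions of (1 (x) r) M vanish, so this row is 0 by [tensor_eq0]; M being invertible, 1
    (x) r = 0. *)
Lemma contract_mx_span (r : 'rV[K]_n) :
  (forall theta, r *m contract_mx theta = 0) -> r = 0.
Proof.
move=> rN; pose r0 : 'rV[L2 L]_n := map_mx (d1_0 L) r.
have rM : r0 *m M = 0.
  apply/rowP => j; rewrite !mxE; apply: tensor_eq0 => theta.
  have /rowP/(_ j) := rN theta; rewrite !mxE => <-.
  rewrite (raddf_sum (contract theta)); apply: eq_bigr => k _; rewrite !mxE.
  exact: contract_d1_0.
have r00 : r0 = 0 by rewrite -[r0]mulmx1 -MM' mulmxA rM mul0mx.
apply/rowP => j; have /rowP/(_ j) := r00; rewrite !mxE; exact: d1_0_inj.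
Qed.

(** The columns of X are invariant vectors of the descent datum M. Their number is free, so that
    columns can be adjoined and selected. *)
Definition descended m (X : 'M[K]_(n, m)) : Prop :=
  M *m map_mx (d1_1 L) X = map_mx (d1_0 L) X.

Lemma descended_row_mx m1 m2 (X : 'M[K]_(n, m1)) (Y : 'M[K]_(n, m2)) :
  descended X -> descended Y -> descended (row_mx X Y).
Proof. by rewrite /descended !map_row_mx mul_mx_row => -> ->. Qed.

Lemma descended_colsub m1 m2 (h : 'I_m2 -> 'I_m1) (X : 'M[K]_(n, m1)) :
  descended X -> descended (colsub h X).
Proof.
rewrite /descended => E; apply/matrixP => i j.
have /matrixP/(_ i (h j)) := E; rewrite !mxE => <-.
by apply: eq_bigr => k _; rewrite !mxE.
Qed.

(** Take a descended X of maximal rank. Adjoining a contraction N cannot raise the rank, so the left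
    kernel of X also kills N. By [contract_mx_span] that kernel is 0, and n independent columns of X
    are then selected. *)
Theorem hilbert90 : exists2 X : 'M[K]_n, X \in unitmx & descended X.
Proof.
pose P r := `[< exists m (X : 'M[K]_(n, m)), descended X /\ \rank X = r >].
have P0 : exists r, P r.
  exists 0%N; apply/asboolP; exists 0%N, 0; rewrite mxrank0; split=> //.
  by apply/matrixP => i [].
have Pn r : P r -> (r <= n)%N.
  by move=> /asboolP[m [X [_ <-]]]; apply: rank_leq_row.
case: (ex_maxnP P0 Pn) => r /asboolP[m [X [XD rX]]] rmax.
have X_free : row_free X.
  rewrite -kermx_eq0; apply/eqP/row_matrixP => i; rewrite row0.
  apply: contract_mx_span => theta.
  pose N := contract_mx theta.
  have XND : descended (row_mx X N).
    exact: descended_row_mx XD (contract_mx_descent theta).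
  have rXN : (\rank (row_mx X N) <= \rank X)%N.
    by rewrite rX; apply: rmax; apply/asboolP; exists (m + n)%N, (row_mx X N).
  have sub : (kermx (row_mx X N) <= kermx X)%MS.
    rewrite sub_kermx; have := mulmx_ker (row_mx X N).
    by rewrite mul_mx_row -row_mx0 => /eq_row_mx[-> _].
  have : (kermx X <= kermx (row_mx X N))%MS.
    rewrite -(mxrank_leqif_sup sub).2 eqn_leq mxrankS //= !mxrank_ker.
    exact: leq_sub2l.
  rewrite sub_kermx mul_mx_row -row_mx0 => /eqP/eq_row_mx[_ XN].
  by rewrite -row_mul XN row0.
have XT_full : row_full X^T by rewrite /row_full mxrank_tr.
exists (colsub (fullrankfun XT_full) X); last exact: descended_colsub.
by rewrite -unitmx_tr trmx_mxsub fullrowsub_unit.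
Qed.
End Hilbert90.

End Functionals.

(** * Cocycles with values in (SL_2 x SL_2) : C_2 *)

Section Mix.
Variable R : comPzRingType.
Variable e : cpoint 'Z_2 R.

Definition mixmx m n (A B : 'M[R]_(m, n)) : 'M[R]_(m, n) := val e 0 *: A + val e 1 *: B.

Lemma mixmxM m n p (A A' : 'M[R]_(m, n)) (B B' : 'M[R]_(n, p)) :
  mixmx (A *m B) (A' *m B') = mixmx A A' *m mixmx B B'.
Proof.
rewrite /mixmx mulmxDl !mulmxDr -!scalemxAl -!scalemxAr !scalerA.
by rewrite !pt_sqr pt01 pt10 !scale0r addr0 add0r.
Qed.

Lemma mix_ptM (a b a' b' : R) :
  (val e 0 * a + val e 1 * b) * (val e 0 * a' + val e 1 * b') =
  val e 0 * (a * a') + val e 1 * (b * b').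
Proof.
transitivity (val e 0 * val e 0 * (a * a') + val e 1 * val e 1 * (b * b')
  + val e 0 * val e 1 * (a * b' + b * a')); first ring.
by rewrite !pt_sqr pt01 mul0r addr0.
Qed.

Lemma scale_mixmx m n (a b : R) (A B : 'M[R]_(m, n)) :
  (val e 0 * a + val e 1 * b) *: mixmx A B = (val e 0 * a) *: A + (val e 1 * b) *: B.
Proof. by apply/matrixP => i j; rewrite !mxE mix_ptM !mulrA. Qed.

Lemma det_mixmx (A B : 'M[R]_2) :
  \det (mixmx A B) = val e 0 * \det A + val e 1 * \det B.
Proof. by rewrite !det2 !mxE !mix_ptM -!mulrN; ring. Qed.
End Mix.

Section Scale.
Variable R : comPzRingType.
(** Right multiplication by this rescales a single column, so the determinant is multiplied by a and
    not by its square. *)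
Definition scale_col0 (a : R) : 'M[R]_2 := diag_mx (\row_j if j == 0 then a else 1).

Lemma det_scale_col0 a : \det (scale_col0 a) = a.
Proof. by rewrite det2 !mxE /= !mulr1n !mulr0n mulr1 mulr0 subr0. Qed.

Lemma mix_scale_col0 (e : cpoint 'Z_2 R) a b :
  mixmx e (scale_col0 a) (scale_col0 b) = scale_col0 (val e 0 * a + val e 1 * b).
Proof.
apply/matrixP => i j; rewrite !mxE; case: (i == j); rewrite ?mulr1n ?mulr0n ?mulr0 ?addr0 //.
by case: ifP => // _; rewrite !mulr1 pt_sum.
Qed.
End Scale.

Lemma map_scale_col0 (R S : comPzRingType) (h : {rmorphism R -> S}) a :
  map_mx h (scale_col0 a) = scale_col0 (h a).
Proof.
apply/matrixP => i j; rewrite !mxE rmorphMn; congr (_ *+ _).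
by case: ifP; rewrite ?rmorph1.
Qed.

(** * A four-dimensional matrix representation *)

Section Embedding.
Variable F : fieldType.
Local Notation G := (SL2xSL2_C2 F).

(** By [Phi_coef] this is the matrix of the action of [Phi] on the odd part (W (x) a) + (a (x)
    W). *)
Definition blockrep (R : comAlg F) (z : G R) : 'M[R]_(2 + 2) :=
  block_mx (val z.2 0 *: val z.1.1) (val z.2 1 *: val z.1.1)
           (val z.2 1 *: val z.1.2) (val z.2 0 *: val z.1.2).

Lemma blockrepM (R : comAlg F) (y z : G R) :
  blockrep (y * z)%g = blockrep y *m blockrep z.
Proof.
case: y z => [[f g] e] [[f' g'] e']; rewrite /blockrep /=.
rewrite !pt_mul0 !pt_mul1 !scalemxAr -![_ *: sval f' + _]/(mixmx e (sval f') (sval g')).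
rewrite -![_ *: sval g' + _]/(mixmx e (sval g') (sval f')) !scale_mixmx mulmx_block.
congr block_mx; rewrite mulmxDr -!scalemxAl -!scalemxAr !scalerA // addrC //.
Qed.

Lemma blockrep1 (R : comAlg F) : blockrep (1%g : G R) = 1%:M.
Proof.
rewrite /blockrep !pt_one !scale1r !scale0r; exact/esym/scalar_mx_block.
Qed.

Lemma blockrep_map (R S : comAlg F) (h : algHom R S) (z : G R) :
  blockrep (gmap h z) = map_mx h (blockrep z).
Proof.
case: z => [[f g] e]; rewrite /blockrep /= map_block_mx !map_mxZ.
by rewrite !ffunE.
Qed.
End Embedding.

(** * Formal properties of maps on H^1 *)

Section Maps.
Variables (F : fieldType) (L : comAlg F).

Lemma cohomologous_map (G H : grpFunctor F) (f : grpHom G H) (phi psi : cocycle L G) :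
  cohomologous phi psi -> cohomologous (cocycle_map f phi) (cocycle_map f psi).
Proof.
move=> /asboolP[lam E]; apply/asboolP; exists (f L lam).
by rewrite /= E !ghomM ghomV !ghom_nat.
Qed.

Lemma H1_map_point (G H : grpFunctor F) (f : grpHom G H) :
  H1_map f (H1_point L G) = H1_point L H.
Proof.
rewrite /H1_point H1_mapE; congr H1_class.
by apply: val_inj; rewrite /= ghom1.
Qed.

Lemma H1_ind (G : grpFunctor F) (P : H1 L G -> Prop) :
  (forall phi, P (H1_class phi)) -> forall x, P x.
Proof. by move=> Pc x; rewrite -(H1_reprK x). Qed.

(** The inverse is induced by f after s: one composite is the identity by p s = 1, the other by the
    hypothesis on cocycles carried along f. *)
Lemma H1_map_retract_bij (A G C : grpFunctor F) (f : grpHom G A) (g : grpHom A G)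
    (p : grpHom G C) (s : grpHom C G) :
  mutually_inverse f g -> (forall R (c : C R), p R (s R c) = c) ->
  (forall phi : cocycle L G, cohomologous phi (cocycle_map s (cocycle_map p phi))) ->
  bijective (@H1_map F L A C (ghom_comp p g)).
Proof.
move=> fg sK ps; exists (H1_map (ghom_comp f s)); elim/H1_ind => phi.
  rewrite !H1_mapE; apply/esym/H1_classP.
  have := cohomologous_map f (ps (cocycle_map g phi)).
  have -> : cocycle_map f (cocycle_map g phi) = phi.
    by apply: val_inj; apply: (fg _).2.
  by congr (is_true (cohomologous _ _)); apply: val_inj.
rewrite !H1_mapE; congr H1_class; apply: val_inj => /=.
by rewrite (fg _).1 sK.
Qed.
End Maps.

Lemma grpHom_inverse (F : fieldType) (G H : grpFunctor F) (f : grpHom G H) :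
  (forall A, injective (f A)) -> (forall A y, exists x, f A x = y) ->
  exists g : grpHom H G, mutually_inverse f g.
Proof.
move=> fI fS; pose g A y := projT1 (cid (fS A y)).
have gK A y : f A (g A y) = y := projT2 (cid (fS A y)).
have gM A x y : g A (x * y)%g = (g A x * g A y)%g by apply: fI; rewrite ghomM !gK.
have gN A B (h : algHom A B) x : g B (gmap h x) = gmap h (g A x).
  by apply: fI; rewrite ghom_nat !gK.
by exists (GrpHom gM gN) => A; split=> x /=; rewrite ?gK //; apply: fI; rewrite gK.
Qed.

Section SemidirectSection.
Variables (F : fieldType) (H N : grpFunctor F) (act : grpAction H N).
Definition sdsect_fun (A : comAlg F) (x : H A) : sdprodG act A := (1%g, x).
Fact sdsectM (A : comAlg F) (x y : H A) :
  sdsect_fun (x * y)%g = (sdsect_fun x * sdsect_fun y)%g.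
Proof. by congr pair; rewrite /= gact_one mulg1. Qed.
Fact sdsect_nat (A B : comAlg F) (h : algHom A B) (x : H A) :
  sdsect_fun (gmap h x) = gmap h (sdsect_fun x).
Proof. by congr pair; rewrite gmap1. Qed.
Definition sdsect : grpHom H (sdprodG act) :=
  @GrpHom F H (sdprodG act) (@sdsect_fun) sdsectM sdsect_nat.
End SemidirectSection.

(** * Reduction of a cocycle to its component in C_2 *)

Section Cocycles.
Variables (F K : fieldType) (iota : {rmorphism F -> K}).
Local Notation L := (@ComAlg F K iota : comAlg F).
Local Notation G := (SL2xSL2_C2 F).
Local Notation d0 := (map_mx (d1_0 L)).
Local Notation d1 := (map_mx (d1_1 L)).

Section OneCocycle.
Variables (f g : slmx 2 (L2 L)) (e : cpoint 'Z_2 (L2 L)).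
Local Notation z := (((f, g), e) : G (L2 L)).
Hypothesis zC : is_cocycle z.

Lemma blockrep_trivial : exists2 X : 'M[K]_(2 + 2), X \in unitmx & descended (blockrep z) X.
Proof.
apply: (@hilbert90 _ _ _ _ (blockrep z) (blockrep (z^-1)%g)).
  by rewrite -blockrepM mulgV blockrep1.
by rewrite -!blockrep_map -blockrepM (eqP zC).
Qed.

Definition twisted n (U V : 'M[K]_(2, n)) : Prop :=
  val f *m mixmx e (d1 U) (d1 V) = d0 U /\ val g *m mixmx e (d1 V) (d1 U) = d0 V.

Lemma descended_twisted n (X : 'M[K]_(2 + 2, n)) :
  descended (blockrep z) X <-> twisted (usubmx X) (dsubmx X).
Proof.
rewrite /descended /twisted -{1 2}(vsubmxK X) !map_col_mx mul_block_col /mixmx.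
rewrite !mulmxDr -!scalemxAl -!scalemxAr [X in col_mx _ X]addrC.
by split=> [/eq_col_mx[]|[-> ->]].
Qed.

Lemma twisted_colsub m n (h : 'I_n -> 'I_m) (U V : 'M[K]_(2, m)) :
  twisted U V -> twisted (colsub h U) (colsub h V).
Proof.
have E k1 k2 (W : 'M[L2 L]_k1) (A B : 'M[L2 L]_(k1, k2)) (p : 'I_n -> 'I_k2) :
  W *m mixmx e (colsub p A) (colsub p B) = colsub p (W *m mixmx e A B).
  by apply/matrixP => i j; rewrite !mxE; apply: eq_bigr => k _; rewrite !mxE.
by move=> [E1 E2]; split; rewrite !map_mxsub E ?E1 ?E2.
Qed.

(** Since f and g have determinant 1, the pair of determinants satisfies the descent equation
    twisted by e alone. *)
Lemma twisted_det (U V : 'M[K]_2) : twisted U V ->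
  d1_0 L (\det U) = val e 0 * d1_1 L (\det U) + val e 1 * d1_1 L (\det V) /\
  d1_0 L (\det V) = val e 0 * d1_1 L (\det V) + val e 1 * d1_1 L (\det U).
Proof.
move=> [/(congr1 determinant) E1 /(congr1 determinant) E2].
rewrite det_mulmx det_mixmx (eqP (valP f)) mul1r !det_map_mx in E1.
by rewrite det_mulmx det_mixmx (eqP (valP g)) mul1r !det_map_mx in E2.
Qed.

Lemma d1_unit (d : algHom L (L2 L)) (x : K) : x != 0 -> d x * d x^-1 = 1.
Proof. by move=> x0; rewrite -rmorphM [_ * _](mulfV x0) rmorph1. Qed.

Lemma exists_twisted : exists2 UV : 'M[K]_2 * 'M[K]_2,
  twisted UV.1 UV.2 & (\det UV.1 != 0) && (\det UV.2 != 0).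
Proof.
have [X Xu /descended_twisted XD] := blockrep_trivial.
have minor (Y : 'M[K]_(2, 2 + 2)) : row_free Y -> exists s, colsub s Y \in unitmx.
  move=> Yf; have YT : row_full Y^T by rewrite /row_full mxrank_tr.
  by exists (fullrankfun YT); rewrite -unitmx_tr trmx_mxsub fullrowsub_unit.
have [s1 u1] : exists s, colsub s (usubmx X) \in unitmx.
  (* The first two columns of the inverse of X form a right inverse of its upper half. *)
  apply: minor; apply/row_freeP; exists (invmx X *m col_mx 1%:M 0).
  by rewrite mul_usub_mx mulKVmx // col_mxKu.
have [s2 u2] : exists s, colsub s (dsubmx X) \in unitmx.
  apply: minor; apply/row_freeP; exists (invmx X *m col_mx 0 1%:M).
  by rewrite mul_dsub_mx mulKVmx // col_mxKd.
have T1 := twisted_colsub s1 XD; have T2 := twisted_colsub s2 XD.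
rewrite unitmxE unitfE in u1; rewrite unitmxE unitfE in u2.
have [V0|V0] := eqVneq (\det (colsub s1 (dsubmx X))) 0; last first.
  by exists (colsub s1 (usubmx X), colsub s1 (dsubmx X)); rewrite //= u1.
(* If the minor V vanishes then e 1 = 0, so U and V are independent of each
   other and V may be replaced. *)
have e1 : val e 1 = 0.
  have [+ _] := twisted_det T1; rewrite V0 rmorph0 mulr0 addr0 => E.
  rewrite -[LHS]mulr1 -(d1_unit (d1_0 L) u1) mulrA E mulrA.
  by rewrite pt10 !mul0r.
exists (colsub s1 (usubmx X), colsub s2 (dsubmx X)); last by apply/andP.
move: T1 T2; rewrite /twisted /mixmx /= e1 !scale0r !addr0.
by move=> [E1 _] [_ E2].
Qed.

Lemma exists_twisted_sl : exists x : SL2xSL2 F L,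
  gmap (d1_0 L) x = ((f, g) * swap_act e (gmap (d1_1 L) x))%g.
Proof.
have [[U V] /= T /andP[U0 V0]] := exists_twisted.
have [dU dV] := twisted_det T.
set u := \det U in U0 dU dV; set v := \det V in V0 dU dV.
(* Pairs mixed by e multiply componentwise, so the scalar descent equation passes to inverses. *)
have inv_mix (x y : K) : x != 0 -> y != 0 ->
    d1_0 L x = val e 0 * d1_1 L x + val e 1 * d1_1 L y ->
    d1_0 L x^-1 = val e 0 * d1_1 L x^-1 + val e 1 * d1_1 L y^-1.
  move=> x0 y0 E; rewrite -[RHS]mul1r -(d1_unit (d1_0 L) x0) [X in X * _]mulrC -mulrA.
  by rewrite E mix_ptM !d1_unit // !mulr1 pt_sum mulr1.
have dUV := inv_mix _ _ U0 V0 dU; have dVU := inv_mix _ _ V0 U0 dV.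
have sc (x y : K) (W : 'M[L2 L]_2) (X Y : 'M[K]_2) :
    d1_0 L x = val e 0 * d1_1 L x + val e 1 * d1_1 L y ->
    W *m mixmx e (d1 X) (d1 Y) = d0 X ->
    W *m mixmx e (d1 (X *m scale_col0 x)) (d1 (Y *m scale_col0 y)) = d0 (X *m scale_col0 x).
  move=> xy E; rewrite !map_mxM !map_scale_col0 mixmxM mix_scale_col0 mulmxA E.
  by rewrite xy.
have dl : \det (U *m scale_col0 u^-1) == 1 by rewrite det_mulmx det_scale_col0 mulfV.
have dm : \det (V *m scale_col0 v^-1) == 1 by rewrite det_mulmx det_scale_col0 mulfV.
have [TU TV] := T.
exists (exist (fun M : 'M_2 => \det M == 1) _ dl, exist (fun M : 'M_2 => \det M == 1) _ dm).
congr pair; apply: val_inj; apply/esym; exact: sc.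
Qed.

Lemma cohomologous_sdsect (phi : cocycle L G) : val phi = z ->
  cohomologous phi (cocycle_map (sdsect (swap F)) (cocycle_map (sdproj (swap F)) phi)).
Proof.
move=> phiz; have [x E] := exists_twisted_sl.
(* With this y, the equation for x reads z d1(y) = d0(y) (1, e); both sides are (d0(x), e). *)
pose y : G L := (x, 1%g).
apply/asboolP; exists y^-1%g; rewrite gmapV [gmap (d1_1 L) _]gmapV invgK -mulgA phiz /= phiz.
apply: (@mulgI _ (gmap (d1_0 L) y)); rewrite mulKVg.
transitivity ((gmap (d1_0 L) x, e) : G (L2 L)).
  have E1 : (gmap (d1_0 L) x * Defs.gact (swap F) (gmap (d1_0 L) (1 : C2 F L)) 1)%g
    = gmap (d1_0 L) x by rewrite gact_one mulg1.
  have E2 : (gmap (d1_0 L) (1 : C2 F L) * e)%g = e by rewrite gmap1 mul1g.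
  exact: (congr2 pair E1 E2).
have E2 : (e * gmap (d1_1 L) (1 : C2 F L))%g = e by rewrite gmap1 mulg1.
exact: (congr2 pair E (esym E2)).
Qed.
End OneCocycle.

Lemma sdsectK (phi : cocycle L G) :
  cohomologous phi (cocycle_map (sdsect (swap F)) (cocycle_map (sdproj (swap F)) phi)).
Proof.
case E : (val phi) => [[f g] e].
by apply: (@cohomologous_sdsect f g e); rewrite // -E (valP phi).
Qed.
End Cocycles.

Theorem theorem2p1 (F : fieldType) (char2 : 2%N \notin [pchar F])
    (B : 'M[F]_2) (skewB : B^T = - B) (nzB : B != 0)
    (Fbar : closedFieldType) (iota : {rmorphism F -> Fbar})
    (algFbar : integralRange iota) :
  exists Psi : grpHom (AutG (K10 B)) (SL2xSL2_C2 F),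
    mutually_inverse (Phi char2 skewB) Psi /\
    let L : comAlg F := @ComAlg F Fbar iota in
    let pi_star : H1 L (AutG (K10 B)) -> H1 L (C2 F) :=
      H1_map (ghom_comp (sdproj (swap F)) Psi) in
    bijective pi_star /\ pi_star (H1_point L (AutG (K10 B))) = H1_point L (C2 F).
Proof.
have [Psi PhiPsi] : exists Psi, mutually_inverse (Phi char2 skewB) Psi.
  apply: grpHom_inverse => R; first exact: Phi_inj.
  exact: Phi_surj.
exists Psi; split=> // L pi_star; split; last exact: H1_map_point.
by apply: (H1_map_retract_bij PhiPsi) => [R c|]; last exact: sdsectK.
Qed.
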